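(* Let $n$ be an integer with $n\geq 5$, and let $l,r$ be nonzero complex numbers such that $r^{2k}\ne1$ for $1\le k\le n$ and $r^{2k}\ne-1$ for $1\le k\le n-1$ (so that the Hecke algebras $\mathcal H(D_n)$ and $\mathcal H_{F,r^2}(n)$ are semisimple). In $V_n$ there exists an irreducible $(n-1)$-dimensional invariant subspace if and only if $l=\frac1{r^{2n-7}}$. If so, it is unique and it is spanned over $\mathbb Q(l,r)$ by the vectors $v_i$, $1\leq i\leq n-1$, with $$\begin{aligned}v_i=\Big(r^{2n-6}-\frac1{r^2}\Big)w_{i,i+1}&+\sum_{j=i+2}^n r^{j-i-4}\Big\{(w_{i+1,j}-r\,w_{i,j})+r^2(\widehat{w_{i+1,j}}-r\,\widehat{w_{i,j}})\Big\}\\&+\sum_{s=1}^{i-1}r^{s-i}\Big\{r^{2n-6}(w_{s,i+1}-r\,w_{s,i})+(\widehat{w_{s,i+1}}-r\,\widehat{w_{s,i}})\Big\}.\end{aligned}$$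
   Context: Put $m=\frac1r-r$ and $F=\mathbb Q(l,r)\subset\mathbb C$. $V_n$ is the $F$-vector space with basis $\{w_{ij},\widehat{w_{ij}}:1\le i<j\le n\}$. It carries endomorphisms $\nu_1,\dots,\nu_n$ defined as follows ($\overline{w_{s,t}}$ stands for either $w_{s,t}$ or $\widehat{w_{s,t}}$, same choice on both sides); they define a representation of the Cohen--Gijsbers--Wales algebra of type $D_n$. $\nu_1$: for $3\le i<j\le n$, $\nu_1(\widehat{w_{ij}})=m r^{j-5}(\widehat{w_{1,i}}-w_{1,i})+m r^{j-4}(\widehat{w_{2,i}}-w_{2,i})+m r^{i-3}(\widehat{w_{1,j}}-w_{1,j})+m r^{i-2}(\widehat{w_{2,j}}-w_{2,j})+m^2(r^{i+j-8}+r^{i+j-6})(\widehat{w_{12}}-w_{12})+r\,\widehat{w_{ij}}$; for $j\ge3$: $\nu_1(\widehat{w_{1j}})=w_{2j}$, $\nu_1(\widehat{w_{2j}})=w_{1j}+m r^{j-3}w_{12}-m\,w_{2j}$, $\nu_1(w_{2j})=\widehat{w_{1j}}+m r^{j-3}\widehat{w_{12}}-m\,w_{2j}$, $\nu_1(w_{1j})=\widehat{w_{2j}}+m r^{j-4}(\widehat{w_{12}}-w_{12})+m(\widehat{w_{1j}}-w_{1j})$; $\nu_1(\widehat{w_{12}})=\frac1l\widehat{w_{12}}$; $\nu_1(\overline{w_{s,t}})=r\,\overline{w_{s,t}}$ for all other basis vectors. $\nu_k$, $2\le k\le n$: $\nu_k(\overline{w_{k-1,t}})=\overline{w_{k,t}}$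 for $t\ge k+1$; $\nu_k(\overline{w_{s,k-1}})=\overline{w_{s,k}}$ for $s\le k-2$; $\nu_k(\widehat{w_{k-1,k}})=r\,\widehat{w_{k-1,k}}$; $\nu_k(w_{k-1,k})=\frac1lw_{k-1,k}$; for $t\ge k+1$: $\nu_k(\widehat{w_{k,t}})=\widehat{w_{k-1,t}}+\frac ml r^{t-k-2}w_{k-1,k}-m\,\widehat{w_{k,t}}$ and $\nu_k(w_{k,t})=w_{k-1,t}+m r^{t-k-1}w_{k-1,k}-m\,w_{k,t}$; for $s\le k-2$: $\nu_k(\overline{w_{s,k}})=\overline{w_{s,k-1}}+\frac{m}{l\,r^{k-s-2}}w_{k-1,k}-m\,\overline{w_{s,k}}$; $\nu_k(\overline{w_{s,t}})=r\,\overline{w_{s,t}}$ for all other basis vectors. An invariant subspace of $V_n$ is an $F$-subspace stable under all $\nu_1,\dots,\nu_n$; it is irreducible if it is nonzero and has no invariant subspaces other than $0$ and itself. $\mathcal H(D_n)$ is the $F$-algebra with generators $g_1,\dots,g_n$, the Artin relations of type $D_n$ (node $1$ joined to node $3$, node $i$ joined to $i+1$ for $2\le i\le n-1$) and $g_i^2+mg_i=1$; $\mathcal H_{F,r^2}(n)$ is the Iwahori--Hecke algebra of $\mathrm{Sym}(n)$ with parameter $r^2$ over $F$. *)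

(* Defs.v *)
From HB Require Import structures.
From mathcomp Require Import all_boot all_order all_algebra.
From mathcomp Require Import boolp reals complex.

Set Implicit Arguments.
Unset Strict Implicit.
Unset Printing Implicit Defensive.

Import Order.TTheory GRing.Theory Num.Theory.
Local Open Scope ring_scope.

Section SubfieldQ.
Variables (C : numFieldType) (l r : C).

(* The smallest subfield of C containing l and r; having characteristic 0, it
   contains the rationals. *)
Definition in_Qlr : {pred C} := fun x =>
  `[< forall S : {pred C}, divring_closed S -> l \in S -> r \in S -> x \in S >].

Lemma in_QlrP x :
  reflect (forall S : {pred C},
             divring_closed S -> l \in S -> r \in S -> x \in S)
          (x \in in_Qlr).
Proof. exact: asboolP. Qed.

Fact in_Qlr_divring : divring_closed in_Qlr.
Proof.
split=> [|x y /in_QlrP Qx /in_QlrP Qy|x y /in_QlrP Qx /in_QlrP Qy].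
- by apply/in_QlrP => S [].
- by apply/in_QlrP => S /[dup] -[_ SB _] cS Sl Sr; apply: SB; [exact: Qx | exact: Qy].
- by apply/in_QlrP => S /[dup] -[_ _ SV] cS Sl Sr; apply: SV; [exact: Qx | exact: Qy].
Qed.

HB.instance Definition _ := GRing.isDivringClosed.Build C in_Qlr in_Qlr_divring.

Record Qlr : Type := MkQlr { Qlr_val : C; Qlr_valP : Qlr_val \in in_Qlr }.

HB.instance Definition _ := [isSub for Qlr_val].
HB.instance Definition _ := [Choice of Qlr by <:].
HB.instance Definition _ := [SubChoice_isSubIntegralDomain of Qlr by <:].
HB.instance Definition _ := [SubIntegralDomain_isSubField of Qlr by <:].

Fact in_Qlr_l : l \in in_Qlr. Proof. by apply/in_QlrP => S _. Qed.
Fact in_Qlr_r : r \in in_Qlr. Proof. by apply/in_QlrP => S _. Qed.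

Definition lQ : Qlr := MkQlr in_Qlr_l.
Definition rQ : Qlr := MkQlr in_Qlr_r.

End SubfieldQ.

(* Labels (h, (i, j)) with 1 <= i < j <= n; h = true for the hatted vectors. *)
Definition label (n : nat) : Type :=
  {b : bool * ('I_n.+1 * 'I_n.+1) | (0 < b.2.1 < b.2.2)%N}.
HB.instance Definition _ n := Finite.on (label n).

Section Representation.
Variables (F : fieldType) (n : nat) (l r : F).

Definition Vn : vectType F := {ffun label n -> F^o}.

(* Indices are ordinary 1-based naturals: the vector is 0 unless
   1 <= i < j <= n. *)
Definition wbar (h : bool) (i j : nat) : Vn :=
  [ffun b : label n => ([&& (val b).1 == h, (val b).2.1 == i :> nat
                         & (val b).2.2 == j :> nat])%:R : F^o].

Local Notation w := (wbar false).
Local Notation wh := (wbar true).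
Local Notation m := (1 / r - r).

Definition nu1_basis (h : bool) (s t : nat) : Vn :=
  if h && (3 <= s)%N then
    (m * r ^ (t%:Z - 5)) *: (wh 1 s - w 1 s)
    + (m * r ^ (t%:Z - 4)) *: (wh 2 s - w 2 s)
    + (m * r ^ (s%:Z - 3)) *: (wh 1 t - w 1 t)
    + (m * r ^ (s%:Z - 2)) *: (wh 2 t - w 2 t)
    + (m ^+ 2 * (r ^ (s%:Z + t%:Z - 8) + r ^ (s%:Z + t%:Z - 6)))
        *: (wh 1 2 - w 1 2)
    + r *: wh s t
  else if [&& h, s == 1 & 3 <= t]%N then w 2 t
  else if [&& h, s == 2 & 3 <= t]%N then
    w 1 t + (m * r ^ (t%:Z - 3)) *: w 1 2 - m *: w 2 t
  else if [&& ~~ h, s == 2 & 3 <= t]%N then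
    wh 1 t + (m * r ^ (t%:Z - 3)) *: wh 1 2 - m *: w 2 t
  else if [&& ~~ h, s == 1 & 3 <= t]%N then
    wh 2 t + (m * r ^ (t%:Z - 4)) *: (wh 1 2 - w 1 2) + m *: (wh 1 t - w 1 t)
  else if [&& h, s == 1 & t == 2]%N then (1 / l) *: wh 1 2
  else r *: wbar h s t.

(* Used for 2 <= k <= n, so that k.-1 is the true predecessor. *)
Definition nuk_basis (k : nat) (h : bool) (s t : nat) : Vn :=
  if (s == k.-1) && (k.+1 <= t)%N then wbar h k t
  else if (t == k.-1) && (s <= k - 2)%N then wbar h s k
  else if (s == k.-1) && (t == k) then
    if h then r *: wh k.-1 k else (1 / l) *: w k.-1 k
  else if (s == k) && (k.+1 <= t)%N then
    if h then
      wh k.-1 t + (m / l * r ^ (t%:Z - k%:Z - 2)) *: w k.-1 k - m *: wh k t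
    else
      w k.-1 t + (m * r ^ (t%:Z - k%:Z - 1)) *: w k.-1 k - m *: w k t
  else if (t == k) && (s <= k - 2)%N then
    wbar h s k.-1 + (m / (l * r ^ (k%:Z - s%:Z - 2))) *: w k.-1 k
    - m *: wbar h s k
  else r *: wbar h s t.

Definition nu_basis (k : nat) (h : bool) (s t : nat) : Vn :=
  if k == 1%N then nu1_basis h s t else nuk_basis k h s t.

Definition nu_fun (k : nat) (x : Vn) : Vn :=
  \sum_(b : label n) (x b : F) *: nu_basis k (val b).1 (val b).2.1 (val b).2.2.

Fact nu_fun_linear k : linear (nu_fun k).
Proof.
move=> a x y; rewrite /nu_fun scaler_sumr -big_split /=; apply: eq_bigr => b _.
by rewrite !ffunE scalerDl scalerA.
Qed.

HB.instance Definition _ k :=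
  GRing.isLinear.Build F Vn Vn _ (nu_fun k) (nu_fun_linear k).

Definition nu (k : nat) : 'End(Vn) := linfun (nu_fun k).

Fact nu_wbar k h s t : (1 <= s)%N -> (s < t)%N -> (t <= n)%N ->
  nu k (wbar h s t) = nu_basis k h s t.
Proof.
move=> s1 st tn; rewrite /nu lfunE /= /nu_fun.
have sn : (s < n.+1)%N by rewrite ltnS (leq_trans (ltnW st)).
have P : (0 < (Ordinal sn) < (Ordinal (tn : (t < n.+1)%N)))%N by rewrite /= s1.
pose b0 : label n := exist _ (h, (Ordinal sn, Ordinal (tn : (t < n.+1)%N))) P.
rewrite (bigD1 b0) //= ffunE /= !eqxx scale1r big1 ?addr0 // => b nb.
rewrite ffunE; case: eqP => //= [e1|]; last by rewrite scale0r.
case: eqP => //= [e2|]; last by rewrite scale0r.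
case: eqP => //= [e3|]; last by rewrite scale0r.
case/eqP: nb; apply: val_inj; case: b e1 e2 e3 => -[h' [i j]] /= _ -> e2 e3.
by congr (_, (_, _)); apply: val_inj.
Qed.

Definition invariant (U : {vspace Vn}) : Prop :=
  forall k : nat, (1 <= k <= n)%N -> (nu k @: U <= U)%VS.

Definition irreducible_invariant (U : {vspace Vn}) : Prop :=
  [/\ invariant U, U <> 0%VS &
      forall W : {vspace Vn}, invariant W -> (W <= U)%VS -> W = 0%VS \/ W = U].

Definition v (i : nat) : Vn :=
  (r ^ (2 * n%:Z - 6) - 1 / r ^+ 2) *: w i i.+1
  + \sum_(i + 2 <= j < n.+1) r ^ (j%:Z - i%:Z - 4) *:
      ((w i.+1 j - r *: w i j) + r ^+ 2 *: (wh i.+1 j - r *: wh i j))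
  + \sum_(1 <= s < i) r ^ (s%:Z - i%:Z) *:
      (r ^ (2 * n%:Z - 6) *: (w s i.+1 - r *: w s i)
       + (wh s i.+1 - r *: wh s i)).

End Representation.

(* Main.v *)
Require Import Defs.
From mathcomp Require Import all_boot all_order all_algebra.
From mathcomp Require Import boolp reals complex.
From HB Require Import structures.
From mathcomp Require Import zify ring.
Import Order.TTheory GRing.Theory Num.Theory.
Local Open Scope ring_scope.

(** Everything is done with coordinates, over an arbitrary field in which r is
    nonzero, r^2 is not -1 and r^(2n) is not 1.  Write x(i,j) for the plain and
    x^(i,j) for the hatted coordinates, m = 1/r - r, q = r^(2n) and
    D_k = nu_k - r.  Away from the plain coordinate (k-1,k), the operator nu_k
    with k >= 2 acts on coordinates by exchanging the indices k-1 and k, in the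
    manner of a Hecke algebra acting on pairs of indices.

    Necessity.  Let U be an invariant subspace of dimension n-1.
    - For x in U the vector D_2 D_4 x involves only the pairs formed from one of
      {1,2} and one of {3,4}, apart from w_12.  Were it nonzero away from w_12,
      moving these pairs around would give n independent vectors of U
      (no_four_point).  Hence the differences x(2,j) - r x(1,j) are
      proportional to r^j on U (slope), for both sorts of coordinates.
    - These differences do not vanish on all of U for hatted coordinates, since
      otherwise three coordinates would determine a vector of U (flat_dim,
      hat_slope).  So D_2 U contains a vector u whose hatted part is that of
      v_1; its plain part depends on two unknown scalars a and c (profile).
    - The vectors nu_k ... nu_3 u, 2 <= k <= n, already have independent hatted
      parts, so they form a basis of U, and a vector of U whose hatted
      coordinates (i,j) vanish for i >= 3 is a multiple of u
      (hat_supported_multiple).  This applies to nu_1 u and to D_1 nu_3 u, and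
      comparing coordinates gives a, c and 1/l = r^(2n-7).  Thus u = v_1.

    Sufficiency.  If 1/l = r^(2n-7), direct computation gives (dev_v, dev1_v)
      D_(i+1) v_i = -(r + 1/r) v_i,  D_(i+2) v_i = r v_(i+1),
      D_i v_i = (1/r) v_(i-1) for i >= 2,  D_1 v_i = D_2 v_i,
    all other D_k v_i with k >= 2 being 0.  So the span S of the v_i is invariant and
    is generated by any single v_k (v_generates).  If sum c_i v_i is killed by
    D_2, ..., D_n, then c_(k+1) - c_k = r^2 (c_k - c_(k-1)) with c_0 = c_n = 0,
    and q <> 1 forces c = 0 (comb_zero).  This gives both dim S = n-1 and the
    irreducibility of S.  Finally the U above contains v_1, so it contains S,
    and equals it for reasons of dimension. *)

(** * Coordinates *)

Section Coordinates.
Context {F : fieldType} {n : nat}.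
Implicit Types (x y : Vn F n) (h : bool).

(** The coordinate of [x] on the basis vector with indices [i], [j] and sort [h];
    it is 0 unless 1 <= i < j <= n. *)
Definition wcoord (h : bool) (i j : nat) (x : Vn F n) : F :=
  \sum_(b : label n | [&& (val b).1 == h, (val b).2.1 == i :> nat
                        & (val b).2.2 == j :> nat]) x b.

(** Linear functionals, as a property of plain functions. *)
Definition scalar_linear (f : Vn F n -> F) : Prop :=
  forall a x y, f (a *: x + y) = a * f x + f y.

Lemma wcoordP h i j : scalar_linear (wcoord h i j).
Proof.
move=> a x y; rewrite /wcoord mulr_sumr -big_split /=.
by apply: eq_bigr => b _; rewrite !ffunE.
Qed.

Lemma wcoord0 h i j : wcoord h i j 0 = 0.
Proof. by rewrite /wcoord big1 // => b _; rewrite ffunE. Qed.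
Lemma wcoordD h i j x y : wcoord h i j (x + y) = wcoord h i j x + wcoord h i j y.
Proof. by rewrite -[x]scale1r wcoordP mul1r !scale1r. Qed.
Lemma wcoordZ h i j a x : wcoord h i j (a *: x) = a * wcoord h i j x.
Proof. by rewrite -[a *: x]addr0 wcoordP wcoord0 addr0. Qed.
Lemma wcoordN h i j x : wcoord h i j (- x) = - wcoord h i j x.
Proof. by rewrite -scaleN1r wcoordZ mulN1r. Qed.
Lemma wcoordB h i j x y : wcoord h i j (x - y) = wcoord h i j x - wcoord h i j y.
Proof. by rewrite wcoordD wcoordN. Qed.
Lemma wcoord_sum h i j (I : Type) (e : seq I) (P : pred I) (f : I -> Vn F n) :
  wcoord h i j (\sum_(a <- e | P a) f a) = \sum_(a <- e | P a) wcoord h i j (f a).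
Proof. by apply: (big_morph _ (wcoordD h i j) (wcoord0 h i j)). Qed.

Definition wcoordE := (wcoordB, wcoordD, wcoordN, wcoordZ, wcoord0).

(** The default value 0 is never used on genuine labels. *)
Lemma wcoord_label (b : label n) x :
  wcoord (val b).1 (val b).2.1 (val b).2.2 x = x b.
Proof.
rewrite /wcoord (bigD1 b) /= ?eqxx // big1 ?addr0 // => c /andP[] /and3P[].
move=> /eqP e1 /eqP e2 /eqP e3 /eqP[].
apply: val_inj; case: c b e1 e2 e3 => -[h [i j]] /= _ [[h' [i' j']] /= _] -> e2 e3.
by congr (_, (_, _)); apply: val_inj.
Qed.

Lemma wcoord_out h i j x : ~~ [&& 0 < i, i < j & j <= n]%N -> wcoord h i j x = 0.
Proof.
move=> out; rewrite /wcoord big_pred0 // => b; apply/negP => /and3P[_ /eqP ei /eqP ej].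
case/negP: out; case: b ei ej => -[h' [i' j']] /= /andP[i0 ij] <- <-.
by rewrite i0 ij -ltnS ltn_ord.
Qed.

Lemma wcoord_wbar h i j h' i' j' :
  wcoord h i j (wbar F n h' i' j') =
  ([&& h == h', i == i', j == j', 0 < i, i < j & j <= n]%N)%:R.
Proof.
have [/and3P[i0 ij jn]|out] := boolP [&& 0 < i, i < j & j <= n]%N; last first.
  by rewrite wcoord_out ?andbF.
rewrite !andbT.
have iN : (i < n.+1)%N by lia.
have jN : (j < n.+1)%N by lia.
have P : (0 < (h, (Ordinal iN, Ordinal jN)).2.1 <
              (h, (Ordinal iN, Ordinal jN)).2.2)%N by rewrite /= i0.
have := wcoord_label (exist _ (h, (Ordinal iN, Ordinal jN)) P : label n)
  (wbar F n h' i' j').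
by rewrite /= => ->; rewrite ffunE.
Qed.

Lemma wcoord_eq0 x :
  (forall h i j, (0 < i)%N -> (i < j)%N -> (j <= n)%N -> wcoord h i j x = 0) -> x = 0.
Proof.
move=> x0; apply/ffunP => b; rewrite ffunE -wcoord_label; apply: x0.
- by case: b => -[h [i j]] /= /andP[].
- by case: b => -[h [i j]] /= /andP[].
- by rewrite -ltnS ltn_ord.
Qed.

Lemma wcoord_inj x y :
  (forall h i j, (0 < i)%N -> (i < j)%N -> (j <= n)%N ->
     wcoord h i j x = wcoord h i j y) -> x = y.
Proof.
move=> xy; apply/eqP; rewrite -subr_eq0; apply/eqP/wcoord_eq0 => h i j i0 ij jn.
by rewrite wcoordB xy ?subrr.
Qed.

Lemma wbar_expansion x :
  x = \sum_(b : label n) x b *: wbar F n (val b).1 (val b).2.1 (val b).2.2.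
Proof.
apply/ffunP => b; rewrite sum_ffunE (bigD1 b) //= !ffunE !eqxx /= big1.
  by rewrite addr0 [_ *: _]mulr1.
move=> c; rewrite !ffunE; case: and3P => [[/eqP e1 /eqP e2 /eqP e3] /eqP[]|_ _].
  apply: val_inj; case: c b e1 e2 e3 => -[h [i j]] /= _ [[h' [i' j']] /= _] -> e2 e3.
  by congr (_, (_, _)); apply: val_inj.
exact: scaler0.
Qed.

Lemma scalar_linear_ext (f g : Vn F n -> F) :
    scalar_linear f -> scalar_linear g ->
    (forall h i j, (0 < i)%N -> (i < j)%N -> (j <= n)%N ->
       f (wbar F n h i j) = g (wbar F n h i j)) ->
  f =1 g.
Proof.
have f0 (u : Vn F n -> F) : scalar_linear u -> u 0 = 0.
  by move=> lu; have := lu (-1) 0 0; rewrite scaler0 addr0 mulN1r addNr.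
have fs (u : Vn F n -> F) : scalar_linear u -> forall e : seq (label n), forall x,
    u (\sum_(b <- e) x b *: wbar F n (val b).1 (val b).2.1 (val b).2.2) =
    \sum_(b <- e) x b * u (wbar F n (val b).1 (val b).2.1 (val b).2.2).
  move=> lu; elim=> [|b e IH] x; first by rewrite !big_nil f0.
  by rewrite !big_cons lu IH.
move=> lf lg fg x; rewrite [x in LHS]wbar_expansion [x in RHS]wbar_expansion !fs //.
apply: eq_bigr => b _; congr (_ * _); apply: fg.
- by case: b => -[h [i j]] /= /andP[].
- by case: b => -[h [i j]] /= /andP[].
- by rewrite -ltnS ltn_ord.
Qed.

Lemma scalar_linearD f g : scalar_linear f -> scalar_linear g ->
  scalar_linear (fun x => f x + g x).
Proof. by move=> lf lg a x y; rewrite lf lg mulrDr addrACA. Qed.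
Lemma scalar_linearN f : scalar_linear f -> scalar_linear (fun x => - f x).
Proof. by move=> lf a x y; rewrite lf opprD mulrN. Qed.
Lemma scalar_linearM c f : scalar_linear f -> scalar_linear (fun x => c * f x).
Proof. by move=> lf a x y; rewrite lf mulrDr mulrCA. Qed.
Lemma scalar_linear_sum (I : Type) (e : seq I) (P : pred I) (f : I -> Vn F n -> F) :
    (forall i, scalar_linear (f i)) ->
  scalar_linear (fun x => \sum_(i <- e | P i) f i x).
Proof.
move=> lf a x y; rewrite mulr_sumr -big_split /=.
by apply: eq_bigr => i _; rewrite lf.
Qed.
Lemma scalar_linear_wcoord h i j (f : 'End(Vn F n)) :
  scalar_linear (fun x => wcoord h i j (f x)).
Proof. by move=> a x y; rewrite linearP wcoordP. Qed.

End Coordinates.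

(* Solves linearity goals for combinations and sums of coordinates. *)
Ltac scalar_linear :=
  repeat first [ apply: scalar_linear_wcoord | apply: wcoordP
               | apply: scalar_linear_sum => ?
               | apply: scalar_linearD | apply: scalar_linearN | apply: scalar_linearM ].

(* Decides each conditional of the goal by arithmetic, and splits on it otherwise. *)
Ltac split_ifs :=
  repeat match goal with
  | |- context [if ?b then _ else _] =>
      first [ (have -> : b = true by lia) | (have -> : b = false by lia)
            | (let E := fresh "E" in case E : b) ]; cbv iota
  end.

Section Sums.
Variables (F : fieldType) (n : nat).

(** The next three lemmas evaluate, on a basis vector, the sums of coordinates
    that occur in the formulas for the generators. *)
Lemma sum_wcoord_wbar2 a b h i h' i' j' (G : nat -> F) :
  \sum_(a <= j < b) G j * wcoord h i j (wbar F n h' i' j') =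
  if [&& a <= j' < b, h == h', i == i', 0 < i, i < j' & j' <= n]%N then G j' else 0.
Proof.
under eq_bigr do rewrite wcoord_wbar.
rewrite -(big_nat1_cond_eq (GRing.add : Monoid.law 0) _
  (fun j => [&& h == h', i == i', 0 < i, i < j & j <= n]%N)) [RHS]big_mkcond /=.
apply: eq_bigr => j _; have [->|_] := eqVneq j j'; rewrite ?andbT ?andbF /= ?mulr0 //.
by case: ifP; rewrite ?mulr1 ?mulr0.
Qed.

Lemma sum_wcoord_wbar1 a b h j h' i' j' (G : nat -> F) :
  \sum_(a <= i < b) G i * wcoord h i j (wbar F n h' i' j') =
  if [&& a <= i' < b, h == h', j == j', 0 < i', i' < j & j <= n]%N then G i' else 0.
Proof.
under eq_bigr do rewrite wcoord_wbar.
rewrite -(big_nat1_cond_eq (GRing.add : Monoid.law 0) _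
  (fun i => [&& h == h', j == j', 0 < i, i < j & j <= n]%N)) [RHS]big_mkcond /=.
apply: eq_bigr => i _; have [->|_] := eqVneq i i'; rewrite ?andbT ?andbF /= ?mulr0 //.
by case: ifP; rewrite ?mulr1 ?mulr0.
Qed.


Lemma sum_wcoord_wbar12 a h h' i' j' (G : nat -> nat -> F) :
  \sum_(a <= i < n.+1) \sum_(i.+1 <= j < n.+1) G i j * wcoord h i j (wbar F n h' i' j') =
  if [&& h == h', a <= i', 0 < i', i' < j' & j' <= n]%N then G i' j' else 0.
Proof.
under eq_bigr do rewrite sum_wcoord_wbar2.
rewrite (eq_bigr (fun i => if i == i' then if
  [&& h == h', 0 < i, i < j' & j' <= n]%N then G i j' else 0 else 0)).
  rewrite -big_mkcond /= big_nat1_eq.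
  by case: h; case: h'; split_ifs.
by move=> i _; have [->|ii] := eqVneq i i'; case: h; case: h'; split_ifs.
Qed.

End Sums.

(** * The generators in coordinates *)

(** Integer powers are turned into quotients of natural powers, which the field
    tactic treats as atoms. *)
Lemma expfz_nat (F : fieldType) (r : F) (z : int) (a b : nat) :
  r != 0 -> z + b%:Z = a%:Z -> r ^ z = r ^+ a / r ^+ b.
Proof.
move=> r0 zab; have -> : z = a%:Z - b%:Z by rewrite -zab addrK.
by rewrite expfzDr // -exprnP exprnN.
Qed.

Ltac split_bools :=
  repeat match goal with
  | |- context [(nat_of_bool ?b)%:R] =>
      first [ (have -> : b = true by lia) | (have -> : b = false by lia)
            | (let E := fresh "E" in case E : b) ]; cbn [nat_of_bool]
  end.

Section GeometricSums.
Variables (F : fieldType) (r : F).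
Hypothesis r0 : r != 0.
Local Notation m := (1 / r - r).

(** The factor m = (1 - r^2)/r makes the sum telescope, whatever r is. *)
Lemma geometric_sum a b : (a <= b)%N ->
  \sum_(a <= t < b) m * (r ^+ t) ^+ 2 = ((r ^+ a) ^+ 2 - (r ^+ b) ^+ 2) / r.
Proof.
elim: b => [|b IH]; first by rewrite leqn0 => /eqP ->; rewrite big_geq // subrr mul0r.
rewrite leq_eqVlt => /predU1P[->|ab]; first by rewrite big_geq // subrr mul0r.
by rewrite big_nat_recr //= IH // (exprS r b); field; exact: r0.
Qed.

Lemma geometric_sum_scale c a b (f : nat -> F) : (a <= b)%N ->
    (forall t, (a <= t < b)%N -> f t = c * (m * (r ^+ t) ^+ 2)) ->
  \sum_(a <= t < b) f t = c * (((r ^+ a) ^+ 2 - (r ^+ b) ^+ 2) / r).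
Proof. by move=> ab fE; rewrite (eq_big_nat _ _ fE) -mulr_sumr geometric_sum. Qed.

End GeometricSums.

Section Generators.
Variables (F : fieldType) (n : nat) (l r : F).
Hypotheses (r0 : r != 0) (l0 : l != 0).
Implicit Types (x : Vn F n) (h : bool).
Local Notation m := (1 / r - r).



Lemma expfz_factor (c : F) (z : int) (a b : nat) : z + b%:Z = a%:Z -> c * r ^ z = c * r ^+ a / r ^+ b.
Proof. by move=> zab; rewrite (@expfz_nat F r z a b r0 zab) mulrA. Qed.

Lemma expfz_factor2 (c : F) (i j : nat) :
  c * (r ^ (i%:Z + j%:Z - 8) + r ^ (i%:Z + j%:Z - 6)) =
  c * (1 + r ^+ 2) * r ^+ i * r ^+ j / r ^+ 8.
Proof.
rewrite (@expfz_nat F r _ (i + j) 8 r0); last lia.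
rewrite (@expfz_nat F r _ (i + j + 2) 8 r0); last lia.
by rewrite !exprD; field; rewrite r0.
Qed.

(* Both sides of a coordinate formula are linear in the vector, so it is enough
   to compare them on each basis vector; [h] is a sort to split on first. *)
Ltac on_basis h :=
  match goal with
  |- wcoord _ _ _ (_ ?x) = _ => move: x; try case: h
  end;
  match goal with
  |- forall x, @?f x = @?g x =>
    apply: (scalar_linear_ext f g); [by scalar_linear | by scalar_linear |];
    let h' := fresh "h'" in let i := fresh "i" in let j := fresh "j" in
    move=> h' i j ? ? ?; rewrite nu_wbar // /nu_basis /nuk_basis /nu1_basis;
    case: h'; split_ifs;
    rewrite ?wcoordE ?(sum_wcoord_wbar1, sum_wcoord_wbar2, sum_wcoord_wbar12)
            ?wcoord_wbar; split_ifs; split_bools;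
    rewrite ?(mulr0, mulr1, addr0, add0r, subr0, sub0r, oppr0) //
  end.

(** The operator with index k+1, for k >= 1, exchanges the indices k and k+1. *)
Lemma nu_left h k t x : (1 <= k)%N -> (k.+1 < t)%N ->
  wcoord h k t (nu n l r k.+1 x) = wcoord h k.+1 t x.
Proof. by move=> k1 kt; on_basis h. Qed.

Lemma nu_left' h k t x : (1 <= k)%N -> (k.+1 < t)%N ->
  wcoord h k.+1 t (nu n l r k.+1 x) = wcoord h k t x - m * wcoord h k.+1 t x.
Proof. by move=> k1 kt; on_basis h. Qed.

Lemma nu_right h s k x : (1 <= s)%N -> (s < k)%N ->
  wcoord h s k (nu n l r k.+1 x) = wcoord h s k.+1 x.
Proof. by move=> s1 sk; on_basis h. Qed.

Lemma nu_right' h s k x : (1 <= s)%N -> (s < k)%N -> (k < n)%N ->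
  wcoord h s k.+1 (nu n l r k.+1 x) = wcoord h s k x - m * wcoord h s k.+1 x.
Proof. by move=> s1 sk kn; on_basis h. Qed.

Lemma nu_hat_diag k x : (1 <= k)%N ->
  wcoord true k k.+1 (nu n l r k.+1 x) = r * wcoord true k k.+1 x.
Proof. by move=> k1; on_basis tt. Qed.

Lemma nu_fix h k s t x : (1 <= k)%N -> s != k -> s != k.+1 -> t != k -> t != k.+1 ->
  wcoord h s t (nu n l r k.+1 x) = r * wcoord h s t x.
Proof. by move=> k1 sk sk1 tk tk1; on_basis h. Qed.

(** The only coordinate of the image where the operator collects contributions
    from many coordinates, and where [l] enters. *)
Lemma nu_diag k x : (1 <= k)%N ->
  wcoord false k k.+1 (nu n l r k.+1 x) =
    1 / l * wcoord false k k.+1 x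
    + (\sum_(k.+2 <= t < n.+1) (m * r ^+ t / r ^+ k.+2) * wcoord false k.+1 t x
       + \sum_(k.+2 <= t < n.+1) (m / l * r ^+ t / r ^+ k.+3) * wcoord true k.+1 t x)
    + (\sum_(1 <= s < k) (m / l * r ^+ s.+1 / r ^+ k) * wcoord false s k.+1 x
       + \sum_(1 <= s < k) (m / l * r ^+ s.+1 / r ^+ k) * wcoord true s k.+1 x).
Proof.
move=> k1; on_basis tt.
- by apply: expfz_factor; lia.
- rewrite (@expfz_nat F r _ k i.+1 r0); last lia.
  by field; rewrite l0 r0 !expf_neq0.
- by apply: expfz_factor; lia.
- rewrite (@expfz_nat F r _ k i.+1 r0); last lia.
  by field; rewrite l0 r0 !expf_neq0.
Qed.

(** The operator with index 1 involves hatted coordinates (i,j), i >= 3, in each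
    coordinate whose first index is 1 or 2. *)
Lemma nu1_fix h i j x : (3 <= i)%N ->
  wcoord h i j (nu n l r 1 x) = r * wcoord h i j x.
Proof. by move=> i3; on_basis h. Qed.

Lemma nu1_hat1 t x : (3 <= t)%N ->
  wcoord true 1 t (nu n l r 1 x) =
    wcoord false 2 t x + m * wcoord false 1 t x
    + (\sum_(t.+1 <= j < n.+1) (m * r ^+ j / r ^+ 5) * wcoord true t j x
       + \sum_(3 <= i < t) (m * r ^+ i / r ^+ 3) * wcoord true i t x).
Proof.
move=> t3; on_basis tt; rewrite ?mulrN1 //;
  try (congr (- _)); try (apply: expfz_factor; lia).
Qed.
Lemma nu1_hat2 t x : (3 <= t)%N ->
  wcoord true 2 t (nu n l r 1 x) =
    wcoord false 1 t x
    + (\sum_(t.+1 <= j < n.+1) (m * r ^+ j / r ^+ 4) * wcoord true t j x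
       + \sum_(3 <= i < t) (m * r ^+ i / r ^+ 2) * wcoord true i t x).
Proof.
move=> t3; on_basis tt; rewrite ?mulrN1 //;
  try (congr (- _)); try (apply: expfz_factor; lia).
Qed.
Lemma nu1_plain1 t x : (3 <= t)%N ->
  wcoord false 1 t (nu n l r 1 x) =
    wcoord true 2 t x - m * wcoord false 1 t x
    - (\sum_(t.+1 <= j < n.+1) (m * r ^+ j / r ^+ 5) * wcoord true t j x
       + \sum_(3 <= i < t) (m * r ^+ i / r ^+ 3) * wcoord true i t x).
Proof.
move=> t3; on_basis tt; rewrite ?mulrN1 //;
  try (congr (- _)); try (apply: expfz_factor; lia).
Qed.
Lemma nu1_plain2 t x : (3 <= t)%N ->
  wcoord false 2 t (nu n l r 1 x) =
    wcoord true 1 t x - m * (wcoord true 2 t x + wcoord false 2 t x)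
    - (\sum_(t.+1 <= j < n.+1) (m * r ^+ j / r ^+ 4) * wcoord true t j x
       + \sum_(3 <= i < t) (m * r ^+ i / r ^+ 2) * wcoord true i t x).
Proof.
move=> t3; on_basis tt; rewrite ?mulrN1 //;
  try (congr (- _)); try (apply: expfz_factor; lia).
Qed.
Lemma nu1_plain12 x : (2 <= n)%N ->
  wcoord false 1 2 (nu n l r 1 x) =
    r * wcoord false 1 2 x
    + (\sum_(3 <= t < n.+1) (m * r ^+ t / r ^+ 3) * wcoord true 2 t x
       - \sum_(3 <= t < n.+1) (m * r ^+ t / r ^+ 4) * wcoord false 1 t x)
    - \sum_(3 <= i < n.+1) \sum_(i.+1 <= j < n.+1)
        (m ^+ 2 * (1 + r ^+ 2) * r ^+ i * r ^+ j / r ^+ 8) * wcoord true i j x.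
Proof.
move=> n2; on_basis tt; rewrite ?mulrN1 //;
  try (congr (- _)); try (by apply: expfz_factor; lia);
  exact: expfz_factor2.
Qed.
Lemma nu1_hat12 x : (2 <= n)%N ->
  wcoord true 1 2 (nu n l r 1 x) =
    1 / l * wcoord true 1 2 x
    + (\sum_(3 <= t < n.+1) (m * r ^+ t / r ^+ 3) * wcoord false 2 t x
       + \sum_(3 <= t < n.+1) (m * r ^+ t / r ^+ 4) * wcoord false 1 t x)
    + \sum_(3 <= i < n.+1) \sum_(i.+1 <= j < n.+1)
        (m ^+ 2 * (1 + r ^+ 2) * r ^+ i * r ^+ j / r ^+ 8) * wcoord true i j x.
Proof.
move=> n2; on_basis tt; rewrite ?mulrN1 //;
  try (congr (- _)); try (by apply: expfz_factor; lia);
  exact: expfz_factor2.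
Qed.

End Generators.

(** * Invariant subspaces of dimension n - 1 *)

Lemma sum_nat0 (F : fieldType) a b (f : nat -> F) :
  (forall i, (a <= i < b)%N -> f i = 0) -> \sum_(a <= i < b) f i = 0.
Proof. by move=> f0; rewrite big_nat big1. Qed.

Section Triangular.
Variables (F : fieldType) (n : nat).

(** Vectors are independent when some functionals form with them a triangular
    matrix with nonzero diagonal. *)
Lemma triangular_dim (U : {vspace Vn F n}) N (e : nat -> Vn F n)
    (f : nat -> Vn F n -> F) :
    (forall i, scalar_linear (f i)) ->
    (forall i, (i < N)%N -> e i \in U) ->
    (forall i j, (i < N)%N -> (j < i)%N -> f i (e j) = 0) ->
    (forall i, (i < N)%N -> f i (e i) != 0) ->
  (N <= \dim U)%N.
Proof.
move=> lf eU tri diag.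
have f_sum i (k : 'I_N -> F) :
    f i (\sum_(j < N) k j *: e j) = \sum_(j < N) k j * f i (e j).
  elim/big_rec2: _ => [|j a b _ IH]; last by rewrite lf IH.
  by have := lf i (-1) 0 0; rewrite scaler0 addr0 mulN1r addNr.
have freeX : free [tuple e i | i < N].
  apply/freeP => k k0 i; apply/eqP; apply: contraT => ki.
  (* The functional attached to the last nonzero coefficient isolates it. *)
  case: (@arg_maxnP _ i (fun j => k j != 0) val ki) => j kj jmax.
  have := f_sum j k.
  have -> : \sum_(j0 < N) k j0 *: e j0 = 0.
    by rewrite -[RHS]k0; apply: eq_bigr => a _; rewrite -tnth_nth tnth_mktuple.
  rewrite (bigD1 j) //= big1 ?addr0.
    move=> /esym; have := lf j (-1) 0 0; rewrite scaler0 addr0 mulN1r addNr => -> /eqP.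
    by rewrite mulf_eq0 (negbTE kj) (negbTE (diag _ (ltn_ord j))).
  move=> a aj; have [ka|/jmax ka] := eqVneq (k a) 0; first by rewrite ka mul0r.
  rewrite tri ?mulr0 //.
  by rewrite ltn_neqAle (ka : (a <= j)%N) andbT; apply: contra aj => /eqP/val_inj ->.
have := freeX; rewrite /free size_tuple => /eqP <-.
by apply/dimvS/span_subvP => x /tnthP[i ->]; rewrite tnth_mktuple eU.
Qed.

Lemma dim_le_functionals (U : {vspace Vn F n}) N (f : nat -> Vn F n -> F) :
    (forall i, scalar_linear (f i)) ->
    (forall x, x \in U -> (forall i, (i < N)%N -> f i x = 0) -> x = 0) ->
  (\dim U <= N)%N.
Proof.
move=> lf inj.
pose g (x : Vn F n) : 'rV[F]_N := \row_i f i x.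
have gl : linear g.
  by move=> a x y; apply/rowP => i; rewrite !mxE lf.
pose gL : {linear Vn F n -> 'rV[F]_N} :=
  HB.pack g (GRing.isLinear.Build _ _ _ _ g gl).
have := limg_ker_dim (linfun gL) U.
have -> : (U :&: lker (linfun gL) = 0)%VS.
  apply/eqP; rewrite -subv0; apply/subvP => x; rewrite memv_cap memv_ker lfunE /=.
  move=> /andP[xU /eqP gx]; rewrite memv0; apply/eqP/inj => // i iN.
  by have := congr1 (fun M : 'rV[F]_N => M 0 (Ordinal iN)) gx; rewrite !mxE.
rewrite dimv0 add0n => <-; apply: leq_trans (dimvS (subvf _)) _.
by rewrite dimvf /dim /= mul1n.
Qed.

End Triangular.

Section Invariant.
Variables (F : fieldType) (n : nat) (l r : F).
Hypotheses (r0 : r != 0) (l0 : l != 0) (n5 : (5 <= n)%N) (r4 : 1 + r ^+ 2 != 0).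
Implicit Types (x y : Vn F n) (h : bool).
Local Notation m := (1 / r - r).
Local Notation nu := (nu n l r).

(** The operator D_k: it is -(r + 1/r) times the projection on the eigenvalue -1/r
    wherever nu_k satisfies the quadratic Hecke relation. *)
Definition nu_sub_r k x := nu k x - r *: x.
Local Notation dev := nu_sub_r.

Lemma dev_left h k t x : (1 <= k)%N -> (k.+1 < t)%N ->
  wcoord h k t (dev k.+1 x) = wcoord h k.+1 t x - r * wcoord h k t x.
Proof. by move=> k1 kt; rewrite !wcoordE nu_left. Qed.

Lemma dev_left' h k t x : (1 <= k)%N -> (k.+1 < t)%N ->
  wcoord h k.+1 t (dev k.+1 x) = wcoord h k t x - wcoord h k.+1 t x / r.
Proof. by move=> k1 kt; rewrite !wcoordE nu_left' //; field. Qed.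

Lemma dev_right h s k x : (1 <= s)%N -> (s < k)%N ->
  wcoord h s k (dev k.+1 x) = wcoord h s k.+1 x - r * wcoord h s k x.
Proof. by move=> k1 kt; rewrite !wcoordE nu_right. Qed.

Lemma dev_right' h s k x : (1 <= s)%N -> (s < k)%N -> (k < n)%N ->
  wcoord h s k.+1 (dev k.+1 x) = wcoord h s k x - wcoord h s k.+1 x / r.
Proof. by move=> k1 kt kn; rewrite !wcoordE nu_right' //; field. Qed.

Lemma dev_hat_diag k x : (1 <= k)%N -> wcoord true k k.+1 (dev k.+1 x) = 0.
Proof. by move=> k1; rewrite !wcoordE nu_hat_diag // subrr. Qed.

Lemma dev_fix h k s t x :
  (1 <= k)%N -> s != k -> s != k.+1 -> t != k -> t != k.+1 ->
  wcoord h s t (dev k.+1 x) = 0.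
Proof. by move=> *; rewrite !wcoordE nu_fix // subrr. Qed.

Section Subspace.
Variable U : {vspace Vn F n}.
Hypotheses (invU : Defs.invariant l r U) (dimU : (\dim U = n - 1)%N).

Lemma nuU k x : (1 <= k)%N -> (k <= n)%N -> x \in U -> nu k x \in U.
Proof.
move=> k1 kn xU; have /subvP := @invU k ltac:(by rewrite k1 kn).
by apply; rewrite memv_img.
Qed.

Lemma devU k x : (1 <= k)%N -> (k <= n)%N -> x \in U -> dev k x \in U.
Proof. by move=> k1 kn xU; rewrite memvB ?memvZ ?nuU. Qed.

(** [slide y i] is nu_(i+4) ... nu_5 y: the index 4 of [y] is moved to i+4. *)
Fixpoint slide y i := if i is i'.+1 then nu (i' + 5) (slide y i') else y.

Lemma slideU y i : (i + 4 <= n)%N -> y \in U -> slide y i \in U.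
Proof. by move=> + yU; elim: i => //= i IH ni; apply: nuU; [lia|lia|apply: IH; lia]. Qed.

(** The condition on [y] allows only the pairs (1,j), (2,j) with j <= 4.  Sliding
    keeps the pairs with second index at most 3 and moves (1,4), (2,4) to
    (1,i+4), (2,i+4). *)
Lemma slide0 y :
    (forall h s t, (3 <= s)%N || (5 <= t)%N -> wcoord h s t y = 0) ->
  forall i, (i + 4 <= n)%N -> forall h s t,
    (3 <= s)%N || (4 <= t)%N && (t != i + 4)%N -> wcoord h s t (slide y i) = 0.
Proof.
move=> y0; elim=> [|i IH] ni h s t st; first by apply: y0; lia.
have {}IH := IH ltac:(lia); rewrite /= (_ : i + 5 = (i + 4).+1)%N; last lia.
have [/and3P[s0 st' tn]|/wcoord_out->//] := boolP [&& 0 < s, s < t & t <= n]%N.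
have [et|tk] := eqVneq t (i + 4)%N.
  by rewrite et nu_right ?IH //; lia.
have [et|tk1] := eqVneq t (i + 4).+1.
  rewrite et; have [es|sk] := eqVneq s (i + 4)%N.
    rewrite es; case: h; first by rewrite nu_hat_diag ?IH ?mulr0 //; lia.
    rewrite nu_diag //; last lia.
    rewrite IH ?mulr0 ?add0r; last lia.
    rewrite !big_nat !big1 ?addr0 // => a an; rewrite IH ?mulr0 //; lia.
  rewrite nu_right' ?IH ?mulr0 ?subr0 //; try lia.
have [es|sk] := eqVneq s (i + 4)%N.
  by have [?|?] := ltnP (i + 4).+1 t; [rewrite es nu_left ?IH //; lia | lia].
have [es|sk1] := eqVneq s (i + 4).+1.
  have [?|?] := ltnP (i + 4).+1 t; last lia.
  by rewrite es nu_left' ?IH ?mulr0 ?subr0 //; lia.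
by rewrite nu_fix ?IH ?mulr0 //; lia.
Qed.

Lemma slide_top y h :
    (forall h s t, (3 <= s)%N || (5 <= t)%N -> wcoord h s t y = 0) ->
  forall i, (i + 4 <= n)%N -> wcoord h 2 (i + 4) (slide y i) = wcoord h 2 4 y.
Proof.
move=> y0; elim=> [|i IH] ni //=; rewrite (_ : i + 5 = (i + 4).+1)%N; last lia.
rewrite (_ : i.+1 + 4 = (i + 4).+1)%N; last lia.
rewrite nu_right'; try lia.
rewrite IH; last lia.
by rewrite slide0 ?mulr0 ?subr0 //; lia.
Qed.

(** Otherwise U would contain n independent vectors: the slides of [y], detected by
    their coordinates (2,j) for 4 <= j <= n, and three more vectors, detected by
    the coordinates (3,4), (3,5), (4,5). *)
Lemma no_four_point y h : y \in U ->
    (forall h s t, (3 <= s)%N || (5 <= t)%N -> wcoord h s t y = 0) ->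
  wcoord h 2 4 y = 0.
Proof.
move=> yU y0; apply/eqP; apply: contraT => ny.
have z0 := slide0 y y0; have top := slide_top y h y0.
have z3 i t : (i + 4 <= n)%N -> (4 <= t)%N ->
    wcoord h 3 t (nu 3 (slide y i)) = wcoord h 2 t (slide y i).
  by move=> ni t4; rewrite nu_left' // [wcoord h 3 t _]z0 ?mulr0 ?subr0.
have z45 i : (i + 4 <= n)%N -> wcoord h 4 5 (nu 3 (slide y i)) = 0.
  by move=> ni; rewrite nu_fix // z0 ?mulr0.
pose e i := if (i < n - 3)%N then slide y i else
            if i == (n - 3)%N then nu 3 (slide y 0) else
            if i == (n - 2)%N then nu 3 (slide y 1) else nu 4 (nu 3 (slide y 1)).
pose p i := if (i < n - 3)%N then (2, i + 4)%N else
            if i == (n - 3)%N then (3, 4)%N else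
            if i == (n - 2)%N then (3, 5)%N else (4, 5)%N.
have : (n <= \dim U)%N; last by rewrite dimU; lia.
apply: (@triangular_dim _ _ U n e (fun i => wcoord h (p i).1 (p i).2)) => [i|i ni|i j ni ij|i ni].
- exact: wcoordP.
- by rewrite /e; case: ifP => ?; [|case: ifP => ?; [|case: ifP => ?]];
    do ?[apply: nuU; [lia|lia|]]; first [exact: yU | apply: slideU; lia].
- rewrite /e /p; split_ifs; cbn [fst snd].
  all: rewrite ?z45 ?z3 ?z0 ?mulr0 //; try lia.
- rewrite /e /p; split_ifs; cbn [fst snd].
  + by rewrite top //; lia.
  + by rewrite z3 ?(top 0%N) //; lia.
  + by rewrite z3 ?(top 1%N) //; lia.
  + by rewrite (@nu_left' _ _ _ _ r0 l0 h 3 5) // z45 ?mulr0 ?subr0 ?z3 ?(top 1%N) //; lia.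
Qed.

(** The coordinate (2,4) of D_2 D_4 x vanishes. *)
Lemma four_point h x : x \in U ->
  wcoord h 2 4 x - r * wcoord h 1 4 x = r * (wcoord h 2 3 x - r * wcoord h 1 3 x).
Proof.
move=> xU; pose y := dev 2 (dev 4 x).
have yU : y \in U by rewrite !devU //; lia.
have : wcoord h 2 4 y = 0.
  apply: no_four_point => // h' s t st.
  have [/and3P[s0 st' tn]|/wcoord_out->//] := boolP [&& 0 < s, s < t & t <= n]%N.
  have [s3|s3] := leqP 3 s; first by rewrite dev_fix //; lia.
  have [->|->] : s = 1%N \/ s = 2%N by lia.
    by rewrite dev_left ?dev_fix ?mulr0 ?subr0 //; lia.
  by rewrite dev_left' ?dev_fix ?mul0r ?subr0 //; lia.
rewrite dev_left' // !dev_right' //; try lia.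
move=> /(congr1 (fun z => r ^+ 2 * z)); rewrite mulr0 => e; apply/eqP.
rewrite -subr_eq0; apply/eqP; rewrite -[RHS]e; field; exact: r0.
Qed.

(** Applying nu_(j+1) to a relation that holds on all of U shifts its index j. *)
Lemma slope h x j : x \in U -> (3 <= j)%N -> (j <= n)%N ->
  wcoord h 2 j x - r * wcoord h 1 j x =
  r ^+ j / r ^+ 3 * (wcoord h 2 3 x - r * wcoord h 1 3 x).
Proof.
move=> xU j3; elim: j j3 x xU => // j IH; rewrite leq_eqVlt => /predU1P[<-|j3] x xU jn.
  by field; exact: r0.
move: j3; rewrite leq_eqVlt => /predU1P[<-|j4].
  by rewrite four_point //; field; exact: r0.
have := IH ltac:(lia) (nu j.+1 x) ltac:(by rewrite nuU //; lia) ltac:(lia).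
rewrite !nu_right //; try lia.
rewrite !nu_fix //; try lia.
by move=> ->; rewrite (exprS r j); field; exact: r0.
Qed.

(** If the slopes all vanish on U then U is at most 3-dimensional: the hatted
    coordinates of a vector [x] of U are determined by that of index (1,2), and
    the plain ones by the hatted ones of [x] and of its image under nu_1, except
    for the plain coordinate (1,2). *)
Section Flat.
Hypothesis flat : forall h x, x \in U -> wcoord h 2 3 x = r * wcoord h 1 3 x.

Lemma flat_left h k t x : x \in U -> (1 <= k)%N -> (k.+1 < t)%N -> (t <= n)%N ->
  wcoord h k.+1 t x = r * wcoord h k t x.
Proof.
move=> + k1; elim: k k1 x => // k IH _ x xU kt tn.
have [->|k0] := posnP k.
  by apply/eqP; rewrite -subr_eq0 slope ?flat ?subrr ?mulr0 //; lia.
have := IH ltac:(lia) (nu k.+2 x) ltac:(by rewrite nuU //; lia) ltac:(lia) tn.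
rewrite nu_left //; try lia.
by rewrite nu_fix ?IH //; lia.
Qed.

Lemma flat_hat j x : x \in U -> (2 <= j)%N -> (j < n)%N ->
  wcoord true 1 j.+1 x = r * wcoord true 1 j x.
Proof.
move=> + j2; elim: j j2 x => // j IH; rewrite leq_eqVlt => /predU1P[<-|j2] x xU jn.
  have := @flat true (nu 3 x) ltac:(by rewrite nuU //; lia).
  rewrite nu_hat_diag // nu_right' //; try lia.
  rewrite flat // => /(mulfI r0) e.
  apply: (mulfI r0); rewrite (_ : wcoord true 1 2 x = (r + m) * wcoord true 1 3 x).
    by field; exact: r0.
  by rewrite mulrDl e subrK.
have := IH ltac:(lia) (nu j.+2 x) ltac:(by rewrite nuU //; lia) ltac:(lia).
rewrite nu_right //; try lia.
by rewrite nu_fix ?IH //; lia.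
Qed.

Lemma flat_left0 h x : x \in U ->
    (forall t, (1 < t)%N -> (t <= n)%N -> wcoord h 1 t x = 0) ->
  forall s t, wcoord h s t x = 0.
Proof.
move=> xU x0; elim=> [|s IH] t; first exact: wcoord_out.
have [/andP[st tn]|out] := boolP (s.+1 < t <= n)%N; last by apply: wcoord_out; lia.
have [->|s0] := posnP s; first by apply: x0; lia.
by rewrite flat_left ?IH ?mulr0.
Qed.

Lemma flat_hat0 x : x \in U -> wcoord true 1 2 x = 0 -> forall s t, wcoord true s t x = 0.
Proof.
move=> xU x0; apply: flat_left0 => //; elim=> // t IH.
rewrite leq_eqVlt => /predU1P[<-//|t2 tn].
by rewrite flat_hat ?IH ?mulr0 //; lia.
Qed.

Lemma flat_dim : (\dim U <= 3)%N.
Proof.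
pose f i := if i == 0%N then wcoord true 1 2 else
            if i == 1%N then (fun x => wcoord true 1 2 (nu 1 x))
            else wcoord (F := F) (n := n) false 1 2.
apply: (@dim_le_functionals F n U 3 f) => [i|x xU f0].
  by rewrite /f; do !case: ifP => _; scalar_linear.
have x0 := flat_hat0 x xU (f0 0%N isT).
have y0 := flat_hat0 (nu 1 x) ltac:(by rewrite nuU //; lia) (f0 1%N isT).
apply: wcoord_eq0 => -[] i j _ _ _; first exact: x0.
apply: flat_left0 => // t; rewrite leq_eqVlt => /predU1P[<- _|t2 tn].
  exact: (f0 2 isT).
have := y0 2 t; rewrite nu1_hat2 // !big1 ?addr0 // => a _; by rewrite x0 mulr0.
Qed.

End Flat.

(** If the hatted slope vanishes on U, then applying it to nu_1 D_2 x shows that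
    (1 + r^2) times the plain slope of [x] vanishes too. *)
Lemma hat_slope : exists2 x, x \in U & wcoord true 2 3 x - r * wcoord true 1 3 x != 0.
Proof.
apply: contrapT => nex.
have hat0 x : x \in U -> wcoord true 2 3 x - r * wcoord true 1 3 x = 0.
  by move=> xU; apply/eqP; apply: contraT => ?; case: nex; exists x.
suff : (\dim U <= 3)%N by rewrite dimU; lia.
apply: flat_dim => -[] x xU; apply/eqP; rewrite -subr_eq0; first by rewrite hat0.
have := hat0 (nu 1 (dev 2 x)) ltac:(by rewrite nuU ?devU //; lia).
rewrite nu1_hat1 // nu1_hat2 // !sum_nat0 => [|a a3|a a3|a a3|a a3].
all: try (rewrite dev_fix ?mulr0 //; lia).
rewrite dev_left // dev_left' // => e; apply/eqP/(mulfI r4); rewrite mulr0 -e.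
by field; exact: r0.
Qed.

(** The shape of the vectors of D_2 U, normalized:
    c w_12 + sum_(3 <= j <= n) r^(j-3) (a (w_2j - r w_1j) + (w^_2j - r w^_1j)). *)
Definition profile (u : Vn F n) (a c : F) : Prop :=
  forall h i j, (1 <= i)%N -> (i < j)%N -> (j <= n)%N ->
    wcoord h i j u =
      if (3 <= i)%N then 0 else
      if j == 2%N then (if h then 0 else c) else
      (if i == 1%N then - r else 1) * (r ^+ j / r ^+ 3) * (if h then 1 else a).

Lemma profile_exists : exists u a c, u \in U /\ profile u a c.
Proof.
have [x xU xn] := hat_slope.
pose d h := wcoord h 2 3 x - r * wcoord h 1 3 x.
(* D_2 x has the coordinates d h * r^(j-3) at (1,j), to be turned into - r * r^(j-3). *)
pose u := (- r / d true) *: dev 2 x.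
have uU : u \in U by rewrite memvZ ?devU //; lia.
exists u, (d false / d true), (wcoord false 1 2 u); split => // h i j i1 ij jn.
case: ifP => i3; first by rewrite wcoordZ dev_fix ?mulr0 //; lia.
have [j2|j2] := eqVneq j 2%N.
  rewrite j2 (_ : i = 1%N); last lia.
  by case: h => //; rewrite wcoordZ dev_hat_diag ?mulr0.
have slj := slope h x j xU ltac:(lia) jn.
have [i1'|i1'] := eqVneq i 1%N.
  rewrite i1' wcoordZ dev_left ?slj //; last lia.
  by case: h {slj}; rewrite -/(d _); field; rewrite r0 xn.
rewrite (_ : i = 2)%N; last lia.
rewrite wcoordZ dev_left' //; last lia.
have -> : wcoord h 1 j x - wcoord h 2 j x / r = - (wcoord h 2 j x - r * wcoord h 1 j x) / r.
  by field; exact: r0.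
by rewrite slj; case: h {slj}; rewrite -/(d _); field; rewrite r0 xn.
Qed.

Section Profile.
Variables (u : Vn F n) (a c : F).
Hypotheses (uU : u \in U) (pu : profile u a c).

(** [tower i] is nu_(i+2) ... nu_3 u, that is, [u] with its index 2 moved to i+2. *)
Fixpoint tower i := if i is i'.+1 then nu (i' + 3) (tower i') else u.

Lemma towerU i : (i + 2 <= n)%N -> tower i \in U.
Proof. by elim: i => //= i IH ni; apply: nuU; [lia|lia|apply: IH; lia]. Qed.

Lemma tower_hat i s t : (i + 2 <= n)%N -> (2 <= s)%N -> (s < t)%N -> (t <= n)%N ->
  wcoord true s t (tower i) =
    (if s == (i + 2)%N then r ^+ t / r ^+ 3 else 0)
    + (if t == (i + 2)%N then r ^+ s / r else 0).
Proof.
elim: i s t => [|i IH] s t ni s2 st tn.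
  rewrite /= pu //; last lia.
  have [->|s2'] := eqVneq s 2%N; split_ifs; rewrite ?add0r ?addr0 ?mul1r ?mulr1 //.
have {}IH s t := IH s t ltac:(lia).
rewrite /= (_ : i + 3 = (i + 2).+1)%N; last lia.
rewrite (_ : i.+1 + 2 = (i + 2).+1)%N; last lia.
have [et|tk] := eqVneq t (i + 2)%N.
  by rewrite et nu_right ?IH //; try lia; split_ifs; rewrite ?addr0.
have [et|tk1] := eqVneq t (i + 2).+1.
  rewrite et; have [es|sk] := eqVneq s (i + 2)%N.
    rewrite es nu_hat_diag ?IH //; try lia.
    split_ifs; rewrite (exprS r (i + 2)); field; exact: r0.
  rewrite nu_right' ?IH //; try lia.
  by split_ifs; rewrite ?addr0 ?mulr0 ?subr0 ?add0r.
have [es|sk] := eqVneq s (i + 2)%N.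
  by rewrite es nu_left ?IH //; try lia; split_ifs; rewrite ?addr0.
have [es|sk1] := eqVneq s (i + 2).+1.
  rewrite es nu_left' ?IH //; try lia.
  by split_ifs; rewrite ?addr0 ?mulr0 ?subr0 ?add0r.
by rewrite nu_fix ?IH //; try lia; split_ifs; rewrite ?addr0 ?mulr0.
Qed.

Lemma tower_comb_hat (k : nat -> F) s t :
    (2 <= s)%N -> (s < t)%N -> (t <= n)%N ->
  wcoord true s t (\sum_(0 <= i < n - 1) k i *: tower i) =
    k (s - 2)%N * (r ^+ t / r ^+ 3) + k (t - 2)%N * (r ^+ s / r).
Proof.
move=> s2 st tn; rewrite wcoord_sum.
rewrite (eq_big_nat _ _ (F2 := fun i =>
  (if i == (s - 2)%N then k i * (r ^+ t / r ^+ 3) else 0)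
  + (if i == (t - 2)%N then k i * (r ^+ s / r) else 0))).
  by rewrite big_split /= -!big_mkcond !big_nat1_eq; split_ifs.
move=> i ni; rewrite wcoordZ tower_hat //; last lia.
by split_ifs; rewrite ?addr0 ?add0r ?mulr0.
Qed.

(** The relations at (3,4), (3,5), (4,5) have determinant a unit times 1 + r^2, and
    those at (3,j) then give the remaining coefficients. *)
Lemma tower_comb0 (k : nat -> F) :
    (forall s t, (3 <= s)%N -> (s < t)%N -> (t <= n)%N ->
       wcoord true s t (\sum_(0 <= i < n - 1) k i *: tower i) = 0) ->
  forall i, (1 <= i)%N -> (i < n - 1)%N -> k i = 0.
Proof.
move=> x0.
have e s t (s3 : (3 <= s)%N) (st : (s < t)%N) (tn : (t <= n)%N) := x0 s t s3 st tn.
have e34 := e 3 4 ltac:(lia) ltac:(lia) ltac:(lia).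
have e35 := e 3 5 ltac:(lia) ltac:(lia) ltac:(lia).
have e45 := e 4 5 ltac:(lia) ltac:(lia) ltac:(lia).
rewrite tower_comb_hat //= in e34; try lia.
rewrite tower_comb_hat //= in e35; try lia.
rewrite tower_comb_hat //= in e45; try lia.
rewrite !subSS !subn0 in e34 e35 e45.
have k1 : k 1%N = - k 3.
  apply/eqP; rewrite -subr_eq0 opprK; apply/eqP/(mulfI (expf_neq0 2 r0)).
  by rewrite mulr0 -e35; field; exact: r0.
have k2 : k 2 = - (r * k 3).
  apply/eqP; rewrite -subr_eq0 opprK; apply/eqP/(mulfI (expf_neq0 2 r0)).
  by rewrite mulr0 -e45; field; exact: r0.
have k3 : k 3 = 0.
  apply/(mulfI r4)/(mulfI r0)/oppr_inj; rewrite !mulr0 oppr0 -e34 k1 k2.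
  by field; exact: r0.
rewrite k3 ?mulr0 ?oppr0 in k1 k2.
case=> [|[|[|[|i]]]] // _ ni.
have := e 3 (i.+4 + 2)%N ltac:(lia) ltac:(lia) ltac:(lia).
rewrite tower_comb_hat //; try lia.
have nz : r ^+ 3 / r != 0 by rewrite mulf_neq0 ?invr_eq0 ?expf_neq0.
by rewrite k1 mul0r add0r addnK -[RHS](mul0r (r ^+ 3 / r)) => /(mulIf nz).
Qed.

(** The n-1 towers have independent hatted parts, so they span U. *)
Lemma tower_span x : x \in U ->
  exists k : nat -> F, x = \sum_(0 <= i < n - 1) k i *: tower i.
Proof.
pose X := [tuple tower i | i < n - 1].
have XE (k : 'I_(n - 1) -> F) : exists K : nat -> F,
    (forall i, k i = K i) /\
    \sum_(i < n - 1) k i *: X`_i = \sum_(0 <= i < n - 1) K i *: tower i.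
  exists (fun i => oapp k 0 (insub i)); split=> [i|]; first by rewrite valK.
  rewrite big_mkord; apply: eq_bigr => i _.
  by rewrite valK -tnth_nth tnth_mktuple.
have freeX : free X.
  apply/freeP => k; have [K [kK ->]] := XE k; move=> K0.
  have Kpos := tower_comb0 K ltac:(by move=> *; rewrite K0 wcoord0).
  have := congr1 (wcoord true 2 3) K0; rewrite tower_comb_hat //; try lia.
  rewrite wcoord0 (Kpos (3 - 2)%N) ?mul0r ?addr0 //; last lia.
  rewrite divff ?mulr1 ?expf_neq0 // => K00 i; rewrite kK.
  by have [i0|i0] := posnP (val i); [rewrite i0 | apply: Kpos].
have XU : (<<X>> <= U)%VS.
  apply/span_subvP => y /tnthP[i ->]; rewrite tnth_mktuple towerU //.
  by have := ltn_ord i; lia.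
have /eqP <- : (<<X>> == U)%VS.
  by rewrite eqEdim XU /= (eqP (freeX : \dim <<X>> == size X)) size_tuple dimU.
move=> /coord_span xX; have [K [_ e]] := XE (fun i => coord X i x).
by exists K; rewrite [LHS]xX e.
Qed.

Lemma hat_supported_multiple x : x \in U ->
    (forall s t, (3 <= s)%N -> (s < t)%N -> (t <= n)%N -> wcoord true s t x = 0) ->
  exists rho, x = rho *: u.
Proof.
move=> xU; have [k ->] := tower_span x xU; move=> /tower_comb0 k0.
exists (k 0%N); rewrite big_ltn; last lia.
by rewrite big_nat big1 ?addr0 // => i /andP[i1 ni]; rewrite k0 ?scale0r.
Qed.

Lemma nu1_profile : nu 1 u = (- r * a) *: u.
Proof.
have [|s t s3 st tn|rho e] := hat_supported_multiple (nu 1 u).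
- by rewrite nuU //; lia.
- by rewrite nu1_fix // pu ?s3 ?mulr0 //; lia.
rewrite e; congr (_ *: _).
have := congr1 (wcoord true 2 3) e.
rewrite wcoordZ nu1_hat2 // !pu //=; try lia.
rewrite !sum_nat0 => [|i i3|i i3]; try lia.
  by move=> e'; rewrite -[LHS]mulr1 -[1](divff (expf_neq0 3 r0)); move: e'; rewrite !mulr1 !mul1r !addr0 => <-; field; exact: r0.
by rewrite pu ?mulr0 //; lia.
Qed.

Lemma geometric_sum_from3 b : (3 <= b)%N ->
  \sum_(3 <= t < b) m * (r ^+ t) ^+ 2 = (r ^+ 6 - r ^+ (2 * b)) / r.
Proof. by move=> b3; rewrite geometric_sum // -!exprM [(b * 2)%N]mulnC. Qed.

(* The vector D_1 y is a multiple of u; its coordinates determine a and l. *)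
Let y := nu 3 u.

Lemma hat_y t : (4 <= t)%N -> (t <= n)%N ->
  [/\ wcoord true 1 t y = - r * (- r * (r ^+ t / r ^+ 3)) * -1,
      wcoord true 2 t y = 0 & wcoord true 3 t y = r ^+ t / r ^+ 3].
Proof.
move=> t4 tn; have t2 : (t == 2%N) = false by lia.
rewrite /y nu_fix // ?nu_left ?nu_left' //; try lia.
rewrite !pu //; try lia.
by rewrite t2 /=; split; ring.
Qed.

Lemma plain_y t : (4 <= t)%N -> (t <= n)%N ->
  wcoord false 1 t y = - r * (r * (r ^+ t / r ^+ 3) * a) /\ wcoord false 2 t y = 0.
Proof.
move=> t4 tn; have t2 : (t == 2%N) = false by lia.
rewrite /y nu_fix // ?nu_left ?nu_left' //; try lia.
rewrite !pu //; try lia.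
by rewrite t2 /=; split; ring.
Qed.

Lemma hat_y_high s t : (4 <= s)%N -> (s < t)%N -> (t <= n)%N -> wcoord true s t y = 0.
Proof.
move=> s4 st tn; rewrite /y nu_fix ?pu //; try lia.
by rewrite ifT ?mulr0 //; lia.
Qed.

(** From the hatted coordinates (1,4) and (2,4) of D_1 y = rho u. *)
Lemma profile_a : a = 1 / r ^+ 2 /\ dev 1 y = (- r ^+ 2) *: u.
Proof.
have yU : y \in U by rewrite /y nuU //; lia.
have [|s t s3 st tn|rho e] := hat_supported_multiple (dev 1 y).
- by rewrite devU //; lia.
- by rewrite !wcoordE nu1_fix // subrr.
have [h14 h24 h34] := hat_y 4 ltac:(lia) ltac:(lia).
have [p14 p24] := plain_y 4 ltac:(lia) ltac:(lia).
have e1 := congr1 (wcoord true 1 4) e.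
have e2 := congr1 (wcoord true 2 4) e.
rewrite !wcoordE nu1_hat1 // !big_nat1 pu //= in e1; try lia.
rewrite !wcoordE nu1_hat2 // !big_nat1 pu //= in e2; try lia.
rewrite sum_nat0 ?h14 ?h24 ?h34 ?p14 ?p24 in e1; last first.
  by move=> j jn; rewrite hat_y_high ?mulr0 //; lia.
rewrite sum_nat0 ?h14 ?h24 ?h34 ?p14 ?p24 in e2; last first.
  by move=> j jn; rewrite hat_y_high ?mulr0 //; lia.
have rhoE : rho = - r ^+ 2 * a + (1 - r ^+ 2).
  apply: (mulIf r0); rewrite (_ : rho * r = rho * (1 * (r ^+ 4 / r ^+ 3) * 1)).
    by rewrite -e2; field; exact: r0.
  by field; exact: r0.
have aE : a = 1 / r ^+ 2.
  apply/eqP; rewrite -subr_eq0; apply/eqP.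
  move/eqP: e1; rewrite rhoE -subr_eq0 => /eqP e1.
  apply: (mulfI (expf_neq0 2 r0)); apply: oppr_inj.
  rewrite mulr0 oppr0 -[RHS]e1.
  by field; exact: r0.
split => //; rewrite e rhoE aE; congr (_ *: _); field; exact: r0.
Qed.

(** From the plain coordinate (1,2) of nu_1 u = - r a u. *)
Lemma profile_c : c = r ^+ (2 * n) / r ^+ 6 - 1 / r ^+ 2.
Proof.
have [aE _] := profile_a.
have := congr1 (wcoord false 1 2) nu1_profile.
rewrite wcoordZ nu1_plain12 //; last lia.
rewrite (pu false 1 2) //=; last lia.
rewrite (@sum_nat0 F 3 n.+1 (fun i => \sum_(_ <= j < _) _)) => [|i i3]; last first.
  by apply: sum_nat0 => j jn; rewrite pu ?ifT ?mulr0 //; lia.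
rewrite (eq_big_nat _ _ (F2 := fun t => r ^- 6 * (m * (r ^+ t) ^+ 2))); last first.
  move=> t t3; rewrite pu //=; try lia.
  rewrite ifF; last lia.
  by field; exact: r0.
rewrite -mulr_sumr geometric_sum_from3; last lia.
rewrite (eq_big_nat _ _ (F2 := fun t => - a * r ^- 6 * (m * (r ^+ t) ^+ 2))); last first.
  move=> t t3; rewrite pu //=; try lia.
  rewrite ifF; last lia.
  by field; exact: r0.
rewrite -mulr_sumr geometric_sum_from3; last lia.
rewrite mulnS exprD => /eqP; rewrite -subr_eq0 => /eqP e.
apply/eqP; rewrite -subr_eq0; apply/eqP.
have nz : (1 + r ^+ 2) / r != 0 by rewrite mulf_neq0 ?invr_eq0.
apply: (mulfI nz); rewrite mulr0 -[RHS]e aE; field; exact: r0.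
Qed.

(** From the hatted coordinate (1,3) of D_1 y = - r^2 u; [l] enters through the
    plain coordinate (2,3) of [y]. *)
Lemma profile_l : 1 / l = r ^+ (2 * n) / r ^+ 7.
Proof.
have [aE e] := profile_a; have cE := profile_c.
have := congr1 (wcoord true 1 3) e.
rewrite !wcoordE nu1_hat1 // [\sum_(3 <= i < 3) _]big_geq // addr0.
have -> : wcoord false 2 3 y = 1 / l * a - m / l * r * (a + 1).
  rewrite /y nu_diag // !big_nat1 !sum_nat0 => [|t t3|t t3]; try (rewrite pu ?mulr0 //; lia).
  by rewrite !pu //=; try lia; field; rewrite r0 l0.
rewrite /y !nu_right' //; try lia.
rewrite -/y !pu //=; try lia.
rewrite (eq_big_nat _ _ (F2 := fun t => r ^- 8 * (m * (r ^+ t) ^+ 2))); last first.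
  move=> t t3; have [_ _ ->] := hat_y t ltac:(lia) ltac:(lia).
  by field; exact: r0.
have gs := geometric_sum_from3 n.+1 ltac:(lia); rewrite big_ltn in gs; last lia.
rewrite -mulr_sumr (_ : \sum_(4 <= t < n.+1) _ =
  (r ^+ 6 - r ^+ (2 * n.+1)) / r - m * (r ^+ 3) ^+ 2); last by rewrite -gs addrAC subrr add0r.
rewrite mulnS exprD aE cE => /eqP; rewrite -subr_eq0 => /eqP e1.
apply/eqP; rewrite -subr_eq0; apply/eqP/(mulfI (expf_neq0 2 r0)); rewrite mulr0 -[RHS]e1.
by field; rewrite r0 l0.
Qed.

End Profile.

Lemma invariant_contains_profile : exists u, [/\ u \in U,
  profile u (1 / r ^+ 2) (r ^+ (2 * n) / r ^+ 6 - 1 / r ^+ 2) & 1 / l = r ^+ (2 * n) / r ^+ 7].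
Proof.
have [u [a [c [uU pu]]]] := profile_exists.
have [aE _] := profile_a u a c uU pu.
exists u; split=> //; last exact: profile_l uU pu.
by rewrite -(profile_c u a c uU pu) -aE.
Qed.

End Subspace.
End Invariant.

(** * The action of the generators on the vectors v_i *)

Lemma sum_at (F : fieldType) a b p (f : nat -> F) :
    (forall i, (a <= i < b)%N -> i != p -> f i = 0) ->
  \sum_(a <= i < b) f i = if (a <= p < b)%N then f p else 0.
Proof.
move=> f0; rewrite (eq_big_nat _ _ (F2 := fun i => if i == p then f i else 0)).
  by rewrite -big_mkcond big_nat1_eq.
by move=> i ab; have [//|ip] := eqVneq; rewrite f0.
Qed.

Lemma sum_at2 (F : fieldType) a b p (f : nat -> F) :
    (a <= p)%N -> (p.+1 < b)%N ->
    (forall i, (a <= i < b)%N -> i != p -> i != p.+1 -> f i = 0) ->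
  \sum_(a <= i < b) f i = f p + f p.+1.
Proof.
move=> ap pb f0; rewrite (big_cat_nat (n := p.+1)) //=; try lia.
rewrite (sum_at _ _ _ p) => [|i ? ?]; last by apply: f0; lia.
rewrite (sum_at _ _ _ p.+1) => [|i ? ?]; last by apply: f0; lia.
by rewrite !ifT //; lia.
Qed.

(* Substitutes the index equalities recorded by the case splits. *)
Ltac subst_eqs :=
  repeat match goal with
  | H : (?a == ?b) = true |- _ => move/eqP: H => H; try subst
  end.

Section Vectors.
Variables (F : fieldType) (n : nat) (l r : F).
Hypotheses (r0 : r != 0) (l0 : l != 0) (n5 : (5 <= n)%N).
Local Notation m := (1 / r - r).
Local Notation q := (r ^+ (2 * n)).
Local Notation v := (v n r).

(** The coordinates of v_i; meaningful for 1 <= s < t <= n. *)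
Definition v_coord (h : bool) (i s t : nat) : F :=
  if s == i then
    if t == i.+1 then if h then 0 else q / r ^+ 6 - 1 / r ^+ 2
    else - r * (r ^+ t / r ^+ i / r ^+ 4 * if h then r ^+ 2 else 1)
  else if s == i.+1 then r ^+ t / r ^+ i / r ^+ 4 * if h then r ^+ 2 else 1
  else if t == i then - r * (r ^+ s / r ^+ i * if h then 1 else q / r ^+ 6)
  else if t == i.+1 then r ^+ s / r ^+ i * if h then 1 else q / r ^+ 6
  else 0.

Lemma wcoord_v h i s t : (1 <= i)%N -> (i < n)%N -> (1 <= s)%N -> (s < t)%N -> (t <= n)%N ->
  wcoord h s t (v i) = v_coord h i s t.
Proof.
move=> i1 ni s1 st tn; rewrite /Defs.v !wcoordE !wcoord_sum.
rewrite (sum_at _ _ _ t) => [|j jn jt]; last first.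
  rewrite !wcoordE !wcoord_wbar; case: h; split_bools; ring.
rewrite (sum_at _ _ _ s) => [|j jn jt]; last first.
  rewrite !wcoordE !wcoord_wbar; case: h; split_bools; ring.
rewrite !wcoordE !wcoord_wbar.
rewrite (@expfz_nat F r (2 * n%:Z - 6) (2 * n) 6 r0); last lia.
rewrite (@expfz_nat F r (t%:Z - i%:Z - 4) t (i + 4) r0); last lia.
rewrite (@expfz_nat F r (s%:Z - i%:Z) s i r0); last lia.
rewrite (exprD r i 4) /v_coord.
case: h; split_ifs; split_bools.
all: try (exfalso; lia).
all: field; rewrite ?r0 ?expf_neq0 //.
Qed.


Local Notation dev := (nu_sub_r F n l r).

(** The expected coordinates of D_(k+1) v_i. *)
Definition dev_v_coord (h : bool) (k i s t : nat) : F :=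
  if k == i then - (r + 1 / r) * v_coord h i s t
  else if k == i.+1 then r * v_coord h i.+1 s t
  else if i == k.+1 then 1 / r * v_coord h k s t else 0.

Ltac solve_v_coord :=
  rewrite /v_coord; split_ifs; subst_eqs; try (exfalso; lia); rewrite ?exprS; field;
  rewrite ?r0 ?l0 ?expf_neq0 //.


(* k = i, k = i + 1, i = k + 1 or none of these: the relative position of the two nodes. *)
Ltac case_nodes k i :=
  rewrite /dev_v_coord;
  have [?|?] := eqVneq k i;
    [subst i | have [?|?] := eqVneq k i.+1;
      [subst k | have [?|?] := eqVneq i k.+1; [subst i|]]].

Lemma dev_v_left h k i t : (1 <= i)%N -> (i < n)%N -> (1 <= k)%N ->
  (k.+1 < t)%N -> (t <= n)%N ->
  wcoord h k t (dev k.+1 (v i)) = dev_v_coord h k i k t.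
Proof.
move=> i1 ni k1 kt tn; rewrite dev_left // !wcoord_v //; try lia.
by case_nodes k i; case: h; solve_v_coord.
Qed.

Lemma dev_v_left' h k i t : (1 <= i)%N -> (i < n)%N -> (1 <= k)%N ->
  (k.+1 < t)%N -> (t <= n)%N ->
  wcoord h k.+1 t (dev k.+1 (v i)) = dev_v_coord h k i k.+1 t.
Proof.
move=> i1 ni k1 kt tn; rewrite dev_left' // !wcoord_v //; try lia.
by case_nodes k i; case: h; solve_v_coord.
Qed.

Lemma dev_v_right h k i s : (1 <= i)%N -> (i < n)%N -> (1 <= s)%N ->
  (s < k)%N -> (k < n)%N ->
  wcoord h s k (dev k.+1 (v i)) = dev_v_coord h k i s k.
Proof.
move=> i1 ni s1 sk kn; rewrite dev_right // !wcoord_v //; try lia.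
by case_nodes k i; case: h; solve_v_coord.
Qed.

Lemma dev_v_right' h k i s : (1 <= i)%N -> (i < n)%N -> (1 <= s)%N ->
  (s < k)%N -> (k < n)%N ->
  wcoord h s k.+1 (dev k.+1 (v i)) = dev_v_coord h k i s k.+1.
Proof.
move=> i1 ni s1 sk kn; rewrite dev_right' // !wcoord_v //; try lia.
by case_nodes k i; case: h; solve_v_coord.
Qed.

Lemma dev_v_fix h k i s t : (1 <= i)%N -> (i < n)%N -> (1 <= k)%N -> (k < n)%N ->
  (1 <= s)%N -> (s < t)%N -> (t <= n)%N ->
  s != k -> s != k.+1 -> t != k -> t != k.+1 ->
  wcoord h s t (dev k.+1 (v i)) = dev_v_coord h k i s t.
Proof.
move=> i1 ni k1 kn s1 st tn sk sk1 tk tk1; rewrite dev_fix //.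
by case_nodes k i; case: h; solve_v_coord.
Qed.

Lemma dev_v_hat_diag k i : (1 <= i)%N -> (i < n)%N -> (1 <= k)%N -> (k < n)%N ->
  wcoord true k k.+1 (dev k.+1 (v i)) = dev_v_coord true k i k k.+1.
Proof.
move=> i1 ni k1 kn; rewrite dev_hat_diag //.
by case_nodes k i; solve_v_coord.
Qed.

Hypothesis lE : 1 / l = q / r ^+ 7.

Ltac solve_v := rewrite wcoord_v; [|lia..]; solve_v_coord.

Ltac zero_v := move=> *; rewrite wcoord_v; [|lia..]; rewrite /v_coord; split_ifs; exact: mulr0.

Lemma sqr_exprSn : (r ^+ n.+1) ^+ 2 = r ^+ 2 * q.
Proof. by rewrite -exprM mulnC mulnS exprD. Qed.

(** The only coordinate of D_(k+1) v_i that needs the value of [l].  The sums are geometric when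
    k is i or i-1, and reduce to one term when k is i+1; in the other cases they
    reduce to two opposite terms. *)
Lemma nu_v_diag k i : (1 <= i)%N -> (i < n)%N -> (1 <= k)%N -> (k < n)%N ->
  wcoord false k k.+1 (dev k.+1 (v i)) = dev_v_coord false k i k k.+1.
Proof.
move=> i1 ni k1 kn; rewrite /nu_sub_r wcoordB wcoordZ nu_diag //.
have mE : m / l = m * (q / r ^+ 7) by rewrite -lE mulrA mulr1.
rewrite lE !mE.
case_nodes k i.
- rewrite (geometric_sum_scale F r r0 ((r ^+ k) ^- 2 / r ^+ 6)); [|lia|move=> t kt; solve_v].
  rewrite (geometric_sum_scale F r r0 (q / r ^+ 12 / (r ^+ k) ^+ 2)); [|lia|move=> t kt; solve_v].
  rewrite (geometric_sum_scale F r r0 (q / r ^+ 6 / (r ^+ k) ^+ 2 * (q / r ^+ 6))); [|lia|move=> t kt; solve_v].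
  rewrite (geometric_sum_scale F r r0 (q / r ^+ 6 / (r ^+ k) ^+ 2)); [|lia|move=> t kt; solve_v].
  rewrite sqr_exprSn; solve_v.
- rewrite !(@sum_nat0 F i.+3) ; [|zero_v..].
  rewrite !(sum_at F 1 i.+1 i) ; [|zero_v..].
  rewrite ifT; last lia.
  rewrite !wcoord_v; [|lia..]; solve_v_coord.
- rewrite big_ltn; last lia.
  rewrite (geometric_sum_scale F r r0 (- (r ^+ k) ^- 2 / r ^+ 6)); [|lia|move=> t kt; solve_v].
  rewrite big_ltn; last lia.
  rewrite (geometric_sum_scale F r r0 (- q / r ^+ 12 / (r ^+ k) ^+ 2)); [|lia|move=> t kt; solve_v].
  rewrite (geometric_sum_scale F r r0 (- q / r ^+ 6 / (r ^+ k) ^+ 2 * (q / r ^+ 6))); [|lia|move=> t kt; solve_v].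
  rewrite (geometric_sum_scale F r r0 (- q / r ^+ 6 / (r ^+ k) ^+ 2)); [|lia|move=> t kt; solve_v].
  rewrite sqr_exprSn !wcoord_v; [|lia..]; solve_v_coord.
- have [ki|ki] := ltnP k i.
    rewrite !(@sum_nat0 F 1 k); [|zero_v..].
    rewrite !(sum_at2 F k.+2 n.+1 i); [|first [lia|zero_v]..].
    rewrite !wcoord_v; [|lia..]; solve_v_coord.
  rewrite !(@sum_nat0 F k.+2); [|zero_v..].
  rewrite !(sum_at2 F 1 k i); [|first [lia|zero_v]..].
  rewrite !wcoord_v; [|lia..]; solve_v_coord.
Qed.

Lemma dev_v k i : (1 <= i)%N -> (i < n)%N -> (1 <= k)%N -> (k < n)%N ->
  dev k.+1 (v i) = if k == i then - (r + 1 / r) *: v i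
                   else if k == i.+1 then r *: v i.+1
                   else if i == k.+1 then (1 / r) *: v k else 0.
Proof.
move=> i1 ni k1 kn; apply: wcoord_inj => h s t s1 st tn.
transitivity (dev_v_coord h k i s t); last first.
  rewrite /dev_v_coord; case: ifP => [/eqP ?|ki]; first by rewrite wcoordZ wcoord_v.
  case: ifP => [/eqP ?|ki1]; first by subst k; rewrite wcoordZ wcoord_v //; lia.
  by case: ifP => [/eqP ?|ki2]; rewrite ?wcoord0 // wcoordZ wcoord_v //; lia.
have [sk|sk] := eqVneq s k.
  subst s; have [tk|tk] := eqVneq t k.+1; last by apply: dev_v_left => //; lia.
  by subst t; case: h; [apply: dev_v_hat_diag | apply: nu_v_diag].
have [sk1|sk1] := eqVneq s k.+1; first by subst s; apply: dev_v_left' => //; lia.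
have [tk|tk] := eqVneq t k; first by subst t; apply: dev_v_right => //; lia.
have [tk1|tk1] := eqVneq t k.+1; first by subst t; apply: dev_v_right' => //; lia.
exact: dev_v_fix.
Qed.

(** Closed forms of the sums of m r^j v^_i(t,j) over j > t, and of m r^s v^_i(s,t)
    over 3 <= s < t, for t >= 3; they occur in all coordinates of nu_1 v_i. *)
Definition hat_row_sum i t : F :=
  if t == i then - (r ^+ i * r)^-1 * (((r ^+ i.+2) ^+ 2 - r ^+ 2 * q) / r)
  else if t == i.+1 then (r ^+ i * r ^+ 2)^-1 * (((r ^+ i.+2) ^+ 2 - r ^+ 2 * q) / r)
  else 0.

Definition hat_col_sum i t : F :=
  if i == 1%N then 0
  else if i == 2%N then if t == 3%N then 0 else m * r ^+ t / r
  else if t == i then - r / r ^+ i * (((r ^+ 3) ^+ 2 - (r ^+ i) ^+ 2) / r)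
  else if t == i.+1 then (r ^+ i)^-1 * (((r ^+ 3) ^+ 2 - (r ^+ i) ^+ 2) / r)
  else 0.

Lemma sum_hat_row i t c : (1 <= i)%N -> (i < n)%N -> (3 <= t)%N -> (t <= n)%N ->
  \sum_(t.+1 <= j < n.+1) (m * r ^+ j / r ^+ c) * wcoord true t j (v i) = hat_row_sum i t / r ^+ c.
Proof.
move=> i1 ni t3 tn; have rc : r ^+ c != 0 by rewrite expf_neq0.
rewrite /hat_row_sum; have [?|ti] := eqVneq t i.
  subst t; rewrite big_ltn; last lia.
  rewrite (geometric_sum_scale F r r0 (- (r ^+ i * r)^-1 / r ^+ c)); [|lia|move=> j ij; solve_v; rewrite ?rc].
  by rewrite sqr_exprSn; solve_v; rewrite rc.
have [?|ti1] := eqVneq t i.+1.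
  subst t; rewrite (geometric_sum_scale F r r0 ((r ^+ i * r ^+ 2)^-1 / r ^+ c)); [|lia|move=> j ij; solve_v; rewrite ?rc].
  by rewrite sqr_exprSn; field; rewrite rc r0 expf_neq0.
rewrite mul0r; have [lti|lit] := ltnP t i; last by apply: sum_nat0; zero_v.
rewrite (sum_at2 F t.+1 n.+1 i); [|first [lia|zero_v]..].
rewrite !wcoord_v; [|lia..]; solve_v_coord.
Qed.

Lemma sum_hat_col i t c : (1 <= i)%N -> (i < n)%N -> (3 <= t)%N -> (t <= n)%N ->
  \sum_(3 <= s < t) (m * r ^+ s / r ^+ c) * wcoord true s t (v i) = hat_col_sum i t / r ^+ c.
Proof.
move=> i1 ni t3 tn; have rc : r ^+ c != 0 by rewrite expf_neq0.
rewrite /hat_col_sum; have [?|i1'] := eqVneq i 1%N; first by subst i; rewrite mul0r; apply: sum_nat0; zero_v.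
have [?|i2] := eqVneq i 2%N.
  subst i; have [?|t3'] := eqVneq t 3%N; first by subst t; rewrite big_geq ?mul0r.
  rewrite (sum_at F 3 t 3); [|zero_v]; rewrite ifT; last lia.
  by rewrite !wcoord_v; [|lia..]; solve_v_coord.
have [?|ti] := eqVneq t i.
  subst t; rewrite (geometric_sum_scale F r r0 (- r / r ^+ i / r ^+ c)); [|lia|move=> j ij; solve_v].
  by field; rewrite rc r0 expf_neq0.
have [?|ti1] := eqVneq t i.+1.
  subst t; rewrite big_nat_recr /=; last lia.
  rewrite (geometric_sum_scale F r r0 ((r ^+ i)^-1 / r ^+ c)); [|lia|move=> j ij; solve_v].
  rewrite !wcoord_v; [|lia..]; solve_v_coord.
rewrite mul0r; have [lti|lit] := ltnP t i; first by apply: sum_nat0; zero_v.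
rewrite (sum_at2 F 3 t i); [|first [lia|zero_v]..].
rewrite !wcoord_v; [|lia..]; solve_v_coord.
Qed.

Ltac case_node1 i :=
  rewrite /dev_v_coord; have [?|?] := eqVneq i 1%N;
    [subst i | have [?|?] := eqVneq i 2%N; [subst i|]].

Lemma dev1_v_left h i s t : (1 <= i)%N -> (i < n)%N -> (1 <= s)%N -> (s <= 2)%N ->
  (3 <= t)%N -> (t <= n)%N ->
  wcoord h s t (dev 1 (v i)) = dev_v_coord h 1 i s t.
Proof.
move=> i1 ni s1 s2 t3 tn; rewrite /nu_sub_r wcoordB wcoordZ.
have [->|->] : s = 1%N \/ s = 2%N by lia.
  case: h; rewrite ?nu1_hat1 ?nu1_plain1 // sum_hat_row // sum_hat_col // !wcoord_v //; try lia.
    case_node1 i; rewrite /hat_row_sum /hat_col_sum; solve_v_coord.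
  case_node1 i; rewrite /hat_row_sum /hat_col_sum; solve_v_coord.
case: h; rewrite ?nu1_hat2 ?nu1_plain2 // sum_hat_row // sum_hat_col // !wcoord_v //; try lia.
  case_node1 i; rewrite /hat_row_sum /hat_col_sum; solve_v_coord.
case_node1 i; rewrite /hat_row_sum /hat_col_sum; solve_v_coord.
Qed.

(** For i >= 3 the rows i and i+1 cancel each other. *)
Lemma double_sum_v i : (1 <= i)%N -> (i < n)%N ->
  \sum_(3 <= s < n.+1) \sum_(s.+1 <= j < n.+1)
      (m ^+ 2 * (1 + r ^+ 2) * r ^+ s * r ^+ j / r ^+ 8) * wcoord true s j (v i) =
  if i == 2%N then m * (1 + r ^+ 2) / r ^+ 5 * hat_row_sum 2 3 else 0.
Proof.
move=> i1 ni.
rewrite (eq_big_nat _ _ (F2 := fun s => m * (1 + r ^+ 2) * r ^+ s * (hat_row_sum i s / r ^+ 8))).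
  have [?|i2] := eqVneq i 2%N.
    subst i; rewrite (sum_at F 3 n.+1 3) => [|s s3 s3']; last first.
      by rewrite /hat_row_sum; split_ifs; rewrite mul0r mulr0.
    by rewrite ifT; [field; exact: r0|lia].
  have [?|i1'] := eqVneq i 1%N.
    by subst i; apply: sum_nat0 => s s3; rewrite /hat_row_sum; split_ifs; rewrite mul0r mulr0.
  rewrite (sum_at2 F 3 n.+1 i);
    [|lia|lia|by move=> s s3 si si1; rewrite /hat_row_sum; split_ifs; rewrite mul0r mulr0].
  by rewrite /hat_row_sum; split_ifs; rewrite (exprS r i); field; rewrite r0 expf_neq0.
move=> s s3; rewrite -sum_hat_row; try lia.
by rewrite mulr_sumr; apply: eq_big_nat => j _; field; exact: r0.
Qed.

Lemma dev1_v_12 h i : (1 <= i)%N -> (i < n)%N ->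
  wcoord h 1 2 (dev 1 (v i)) = dev_v_coord h 1 i 1 2.
Proof.
move=> i1 ni; rewrite /nu_sub_r wcoordB wcoordZ.
case: h; rewrite ?nu1_hat12 ?nu1_plain12 //; try lia; rewrite double_sum_v // ?lE.
  case_node1 i.
  - rewrite (geometric_sum_scale F r r0 (r ^- 8)); [|lia|move=> t t3; solve_v].
    rewrite (geometric_sum_scale F r r0 (- r ^- 8)); [|lia|move=> t t3; solve_v].
    by rewrite wcoord_v; [|lia..]; solve_v_coord.
  - rewrite big_ltn; last lia.
    rewrite (geometric_sum_scale F r r0 (- r ^- 8)); [|lia|move=> t t3; solve_v].
    rewrite (sum_at F 3 n.+1 3); [|zero_v].
    rewrite sqr_exprSn /hat_row_sum !wcoord_v; [|lia..]; solve_v_coord.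
  - rewrite (sum_at2 F 3 n.+1 i); [|first [lia|zero_v]..].
    rewrite (sum_at2 F 3 n.+1 i); [|first [lia|zero_v]..].
    rewrite !wcoord_v; [|lia..]; solve_v_coord.
case_node1 i.
- rewrite (geometric_sum_scale F r r0 (r ^- 6)); [|lia|move=> t t3; solve_v].
  rewrite (geometric_sum_scale F r r0 (- r ^- 8)); [|lia|move=> t t3; solve_v].
  by rewrite sqr_exprSn wcoord_v; [|lia..]; solve_v_coord.
- rewrite big_ltn; last lia.
  rewrite (geometric_sum_scale F r r0 (- r ^- 6)); [|lia|move=> t t3; solve_v].
  rewrite (sum_at F 3 n.+1 3); [|zero_v].
  rewrite sqr_exprSn /hat_row_sum !wcoord_v; [|lia..]; solve_v_coord.
- rewrite (sum_at2 F 3 n.+1 i); [|first [lia|zero_v]..].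
  rewrite (sum_at2 F 3 n.+1 i); [|first [lia|zero_v]..].
  rewrite !wcoord_v; [|lia..]; solve_v_coord.
Qed.

(** The two nodes 1 and 2 act in the same way on the span of the v_i. *)
Lemma dev1_v i : (1 <= i)%N -> (i < n)%N -> dev 1 (v i) = dev 2 (v i).
Proof.
move=> i1 ni; apply: wcoord_inj => h s t s1 st tn.
transitivity (dev_v_coord h 1 i s t).
  have [s3|s3] := leqP 3 s.
    rewrite /nu_sub_r wcoordB wcoordZ nu1_fix // subrr.
    by case_node1 i; solve_v_coord.
  have [t2|t2] := eqVneq t 2%N; last by apply: dev1_v_left; lia.
  have s1' : s = 1%N by lia.
  by subst s t; apply: dev1_v_12.
rewrite dev_v //; try lia.
rewrite /dev_v_coord; case: ifP => [/eqP ?|ki]; first by rewrite wcoordZ wcoord_v.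
case: ifP => [/eqP ?|ki1]; first lia.
by case: ifP => [/eqP ?|ki2]; rewrite ?wcoord0 // wcoordZ wcoord_v //; lia.
Qed.

End Vectors.

(** * Irreducibility of the span of the v_i and classification *)

Lemma chain_induction (n : nat) (P : nat -> Prop) :
    (forall i, (1 <= i)%N -> (i.+1 < n)%N -> P i -> P i.+1) ->
    (forall i, (1 <= i)%N -> (i.+1 < n)%N -> P i.+1 -> P i) ->
  forall k i, (1 <= k)%N -> (k < n)%N -> P k -> (1 <= i)%N -> (i < n)%N -> P i.
Proof.
move=> up down k i k1 kn Pk.
have P1 : P 1%N.
  elim: k k1 kn Pk => // k IH _ kn; have [->//|k0] := posnP k.
  by move/down=> /(_ k0 kn); apply: IH => //; lia.
elim: i => // i IH _ ni; have [->//|i0] := posnP i.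
by apply: up => //; apply: IH => //; lia.
Qed.

Section Span.
Variables (F : fieldType) (n : nat) (l r : F).
Hypotheses (r0 : r != 0) (l0 : l != 0) (n5 : (5 <= n)%N).
Hypotheses (r4 : 1 + r ^+ 2 != 0) (rn : r ^+ (2 * n) != 1).
Local Notation q := (r ^+ (2 * n)).
Local Notation v := (v n r).
Local Notation dev := (nu_sub_r F n l r).
Local Notation S := <<[seq v i | i <- iota 1 (n - 1)]>>%VS.

Lemma v_neq0 k : (1 <= k)%N -> (k < n)%N -> v k != 0.
Proof.
move=> k1 kn; apply/eqP => vk0.
have [?|k1'] := eqVneq k 1%N.
  subst k; have := congr1 (wcoord true 2 3) vk0.
  rewrite wcoord0 (@wcoord_v F n l r) //; try lia.
  rewrite /v_coord /= => /eqP; apply/negP.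
  by rewrite !(mulf_neq0, expf_neq0, invr_neq0).
have := congr1 (wcoord true 1 k.+1) vk0.
rewrite wcoord0 (@wcoord_v F n l r) //; try lia.
rewrite /v_coord; split_ifs => /eqP; apply/negP.
by rewrite !(mulf_neq0, expf_neq0, invr_neq0) ?oner_neq0.
Qed.

Lemma memv_v i : (1 <= i)%N -> (i < n)%N -> v i \in S.
Proof. by move=> i1 ni; apply/memv_span/map_f; rewrite mem_iota; lia. Qed.

Section Action.
Hypothesis lE : 1 / l = q / r ^+ 7.

(** Up to sign, D_(k+1) applies row k of a deformed Cartan matrix of type A to the
    coefficients. *)
Lemma dev_comb (c : nat -> F) k : c 0%N = 0 -> c n = 0 -> (1 <= k)%N -> (k < n)%N ->
  dev k.+1 (\sum_(1 <= i < n) c i *: v i) =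
  (r * c k.-1 + c k.+1 / r - (r + 1 / r) * c k) *: v k.
Proof.
move=> c0 cn k1 kn.
have -> : dev k.+1 (\sum_(1 <= i < n) c i *: v i) =
          \sum_(1 <= i < n) c i *: dev k.+1 (v i).
  rewrite /nu_sub_r linear_sum scaler_sumr -sumrB; apply: eq_bigr => i _.
  by rewrite linearZ scalerBr scalerA mulrC -scalerA.
rewrite (eq_big_nat _ _ (F2 := fun i =>
  ((if i == k.-1 then r * c i else 0) + (if i == k.+1 then c i / r else 0)
   - (if i == k then (r + 1 / r) * c i else 0)) *: v k)); last first.
  move=> i ni; rewrite dev_v //; try lia.
  have [?|ki] := eqVneq k i.
    by subst i; split_ifs; rewrite scalerA; congr (_ *: _); ring.
  have [?|ki1] := eqVneq k i.+1.
    by subst k; split_ifs; rewrite scalerA; congr (_ *: _); ring.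
  have [?|ik] := eqVneq i k.+1.
    by subst i; split_ifs; rewrite scalerA; congr (_ *: _); field; exact: r0.
  by split_ifs; rewrite scaler0 addr0 subr0 scale0r.
rewrite -scaler_suml; congr (_ *: _).
rewrite sumrB big_split /= -!big_mkcond !big_nat1_eq; congr (_ + _ - _).
- by case: ifP => // ?; rewrite (_ : k.-1 = 0%N) ?c0 ?mulr0 //; lia.
- by case: ifP => // ?; rewrite (_ : k.+1 = n) ?cn ?mul0r //; lia.
- by rewrite ifT //; lia.
Qed.

(** The deformed Cartan matrix is invertible: an element of its kernel would be one of the sequences with
    c_k proportional to 1 + r^2 + ... + r^(2(k-1)), and c_n = 0. *)
Lemma comb_zero (c : nat -> F) : c 0%N = 0 -> c n = 0 ->
    (forall k, (1 <= k)%N -> (k < n)%N -> dev k.+1 (\sum_(1 <= i < n) c i *: v i) = 0) ->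
  forall k, (k < n)%N -> c k = 0.
Proof.
move=> c0 cn dev0.
have rec k : (k.+1 < n)%N -> c k.+2 = (1 + r ^+ 2) * c k.+1 - r ^+ 2 * c k.
  move=> kn; have := dev0 k.+1 isT kn; rewrite dev_comb //.
  move/eqP; rewrite scaler_eq0 (negbTE (v_neq0 k.+1 _ _)) // orbF /= => /eqP e.
  apply/eqP; rewrite -subr_eq0; apply/eqP.
  have -> : c k.+2 - ((1 + r ^+ 2) * c k.+1 - r ^+ 2 * c k) =
            r * (r * c k + c k.+2 / r - (r + 1 / r) * c k.+1) by field; exact: r0.
  by rewrite e mulr0.
have geo k : (k < n)%N -> (1 - r ^+ 2) * c k = c 1%N * (1 - r ^+ (2 * k)) /\
    (1 - r ^+ 2) * c k.+1 = c 1%N * (1 - r ^+ (2 * k.+1)).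
  elim: k => [|k IH] kn; first by rewrite c0 muln0 muln1 expr0 subrr !mulr0; split=> //; ring.
  have [e1 e2] := IH ltac:(lia); split=> //.
  rewrite rec // mulrBr mulrCA e2 [X in _ - X]mulrCA e1.
  by rewrite !mulnS !exprD; ring.
have c1 : c 1%N = 0.
  have [_] := geo n.-1 ltac:(lia); rewrite prednK ?cn ?mulr0; last lia.
  move/esym/eqP; rewrite mulf_eq0 => /orP[/eqP //|].
  by rewrite subr_eq0 eq_sym (negbTE rn).
suff all0 k : (k < n)%N -> c k = 0 /\ c k.+1 = 0 by move=> k /all0 [].
elim: k => [|k IH] kn //; have [e1 e2] := IH ltac:(lia).
by rewrite rec // e1 e2 !mulr0 subr0.
Qed.

Let X := [tuple v i.+1 | i < n - 1].

Let S_tuple : S = <<X>>%VS.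
Proof.
apply: eq_span => y; apply/mapP/tnthP => [|] [ i ].
  rewrite mem_iota => /andP[i1 ni] ->.
  have lt : (i.-1 < n - 1)%N by lia.
  by exists (Ordinal lt); rewrite tnth_mktuple /= prednK.
move=> ->; exists i.+1; last by rewrite tnth_mktuple.
by have := ltn_ord i; rewrite mem_iota; lia.
Qed.

(* Coefficients of a combination of v_1, ..., v_(n-1), extended by 0. *)
Let extend (k : 'I_(n - 1) -> F) : exists c : nat -> F,
  [/\ c 0%N = 0, c n = 0, forall i : 'I_(n - 1), c i.+1 = k i &
      \sum_(i < n - 1) k i *: X`_i = \sum_(1 <= i < n) c i *: v i].
Proof.
pose c j := if j is j'.+1 then oapp k 0 (insub j') else 0.
have cS (i : 'I_(n - 1)) : c i.+1 = k i by rewrite /= valK.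
exists c; split=> //.
  have out j : (n <= j)%N -> c j = 0 by case: j => //= j nj; rewrite insubF //; lia.
  exact: out.
rewrite big_add1 -subn1 big_mkord; apply: eq_bigr => i _.
by rewrite cS -tnth_nth tnth_mktuple.
Qed.

Lemma span_vP x : x \in S ->
  exists c : nat -> F, [/\ c 0%N = 0, c n = 0 & x = \sum_(1 <= i < n) c i *: v i].
Proof.
rewrite S_tuple => /coord_span ->.
by have [c [c0 cn _ ->]] := extend (fun i => coord X i x); exists c.
Qed.

Lemma dim_span_v : \dim S = (n - 1)%N.
Proof.
suff freeX : free X by rewrite S_tuple (eqP (freeX : \dim <<X>> == size X)) size_tuple.
apply/freeP => k; have [c [c0 cn cS ->]] := extend k => c_sum i.
rewrite -cS; apply: comb_zero => // [j _ _|]; last by have := ltn_ord i; lia.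
by rewrite c_sum /nu_sub_r linear0 scaler0 subrr.
Qed.

Lemma invariant_span_v : Defs.invariant l r S.
Proof.
move=> k kn; rewrite limg_span; apply/span_subvP => _ /mapP[_ /mapP[ i ] ii -> ->].
rewrite mem_iota in ii.
suff dS : dev k (v i) \in S.
  by rewrite -[nu _ _ _ _ _](subrK (r *: v i)) memvD // memvZ // memv_v; lia.
have [->|k1] := eqVneq k 1%N; first rewrite dev1_v //; try lia.
  rewrite dev_v //; try lia.
  by split_ifs; first [exact: mem0v | apply/memvZ/memv_v; lia].
case: k k1 kn => // k k1 kn.
rewrite dev_v //; try lia.
by split_ifs; first [exact: mem0v | apply/memvZ/memv_v; lia].
Qed.


(** Neighbouring v_i are obtained from each other by the D_k. *)
Lemma v_generates (W : {vspace Vn F n}) k :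
    Defs.invariant l r W -> (1 <= k)%N -> (k < n)%N -> v k \in W ->
  (S <= W)%VS.
Proof.
move=> invW k1 kn vW.
have devW j x : (1 <= j)%N -> (j <= n)%N -> x \in W -> dev j x \in W.
  by move=> j1 jn xW; apply: devU.
have up i : (1 <= i)%N -> (i.+1 < n)%N -> v i \in W -> v i.+1 \in W.
  move=> i1 ni /(devW i.+2 _ isT ni).
  rewrite dev_v; [|first [assumption | lia]..].
  split_ifs; rewrite rpredZeq (negbTE r0); exact: id.
have down i : (1 <= i)%N -> (i.+1 < n)%N -> v i.+1 \in W -> v i \in W.
  move=> i1 ni /(devW i.+1 _ isT (ltnW ni)).
  rewrite dev_v; [|first [assumption | lia]..].
  split_ifs; rewrite rpredZeq mul1r invr_eq0 (negbTE r0); exact: id.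
apply/span_subvP => _ /mapP[ i ii ->]; rewrite mem_iota in ii.
by apply: (chain_induction n (fun i => v i \in W) up down k) => //; lia.
Qed.

(** Some D_k does not kill a given nonzero vector of an invariant subspace of S, and maps it
    to a nonzero multiple of v_(k-1). *)
Lemma irreducible_span_v : irreducible_invariant l r S.
Proof.
split; first exact: invariant_span_v.
  by move=> S0; have := dim_span_v; rewrite S0 dimv0; lia.
move=> W invW WS; have [->|W0] := eqVneq W 0%VS; first by left.
right; apply/eqP; rewrite eqEsubv WS /=.
have xW := memv_pick W; have x0 : vpick W != 0 by rewrite vpick0.
have [c [c0 cn xE]] := span_vP _ (subvP WS _ xW).
have [dev0|] := pselect (forall k, (1 <= k)%N -> (k < n)%N -> dev k.+1 (vpick W) = 0).
  rewrite xE in dev0; have cz := comb_zero c c0 cn dev0.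
  case/eqP: x0; rewrite xE big_nat big1 // => i /andP[_ ni].
  by rewrite cz ?scale0r.
move=> /existsNP[k] /not_implyP[k1] /not_implyP[kn] devk.
have : dev k.+1 (vpick W) \in W by apply: devU => //; lia.
rewrite xE dev_comb // rpredZeq => /orP[/eqP z|]; last exact: v_generates.
by case: devk; rewrite xE dev_comb // z scale0r.
Qed.

End Action.

Lemma invariant_eq_span_v (U : {vspace Vn F n}) :
    Defs.invariant l r U -> \dim U = (n - 1)%N ->
  1 / l = q / r ^+ 7 /\ U = S.
Proof.
move=> invU dimU.
have [u [uU pu lE]] := invariant_contains_profile F n l r r0 l0 n5 r4 U invU dimU.
have uv : u = v 1.
  apply: wcoord_inj => h i j i1 ij jn.
  rewrite pu // (@wcoord_v F n l r) // /v_coord; last lia.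
  case: h; split_ifs; subst_eqs; try (exfalso; lia).
  all: try by field; rewrite ?r0.
split=> //; apply/eqP; rewrite eq_sym eqEdim dim_span_v // dimU leqnn andbT.
by apply: (v_generates lE U 1) => //; [lia | rewrite -uv].
Qed.

(** The theorem over an arbitrary field. *)
Lemma classification :
  let P (U : {vspace Vn F n}) : Prop := irreducible_invariant l r U /\ \dim U = (n - 1)%N in
  ((exists U, P U) <-> 1 / l = q / r ^+ 7) /\
  (1 / l = q / r ^+ 7 -> exists U, unique P U /\ U = S).
Proof.
move=> P.
have PS : 1 / l = q / r ^+ 7 -> P S by move=> lE; split; [apply: irreducible_span_v | apply: dim_span_v].
split; first split=> [[U [[invU _ _] dimU]]|lE].
- by have [] := invariant_eq_span_v U invU dimU.
- by exists S; apply: PS.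
move=> lE; exists S; split=> //; split=> [|U [[invU _ _] dimU]]; first exact: PS.
by have [_ ->] := invariant_eq_span_v U invU dimU.
Qed.

End Span.

Theorem theorem4 (R : realType) (n : nat) (l r : R[i])
    (hn : (5 <= n)%N) (hl : l <> 0) (hr : r <> 0)
    (hr1 : forall k : nat, (1 <= k <= n)%N -> r ^+ (2 * k) <> 1)
    (hr2 : forall k : nat, (1 <= k <= n - 1)%N -> r ^+ (2 * k) <> -1) :
  let P (U : {vspace Vn (Qlr l r) n}) : Prop :=
    irreducible_invariant (lQ l r) (rQ l r) U /\ \dim U = (n - 1)%N in
  ((exists U, P U) <-> l = 1 / r ^+ (2 * n - 7)) /\
  (l = 1 / r ^+ (2 * n - 7) ->
     exists U, unique P U /\
       U = <<[seq v n (rQ l r) i | i <- iota 1 (n - 1)]>>%VS).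
Proof.
have valX k : Qlr_val (rQ l r ^+ k) = r ^+ k.
  by elim: k => [|k IH] //; rewrite !exprS -IH.
have l0 : lQ l r != 0 by apply/eqP => /(congr1 (@Qlr_val _ l r)).
have r0 : rQ l r != 0 by apply/eqP => /(congr1 (@Qlr_val _ l r)).
have r4 : 1 + rQ l r ^+ 2 != 0.
  apply/eqP => /eqP; rewrite addrC addr_eq0 => /eqP /(congr1 (@Qlr_val _ l r)).
  by rewrite valX => /(hr2 1%N ltac:(lia)).
have rn : rQ l r ^+ (2 * n) != 1.
  by apply/eqP => /(congr1 (@Qlr_val _ l r)); rewrite valX => /(hr1 n ltac:(lia)).
(* The condition on l is transported to the subfield generated by l and r. *)
have -> : (l = 1 / r ^+ (2 * n - 7)) = (1 / lQ l r = rQ l r ^+ (2 * n) / rQ l r ^+ 7).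
  apply/propext.
  have -> : rQ l r ^+ (2 * n) / rQ l r ^+ 7 = rQ l r ^+ (2 * n - 7).
    by rewrite -[in LHS](@subnK 7 (2 * n)) ?exprD ?mulfK ?expf_neq0 //; lia.
  have rX : r ^+ (2 * n - 7) != 0 by rewrite expf_neq0 //; apply/eqP.
  rewrite !div1r; split=> [lE|lE].
    have lr1 : l * r ^+ (2 * n - 7) = 1 by rewrite lE mulVf.
    apply: (mulfI l0); rewrite divff //; apply: val_inj.
    have -> : val (lQ l r * rQ l r ^+ (2 * n - 7)) = l * r ^+ (2 * n - 7) by rewrite -valX.
    exact: esym lr1.
  apply: (mulIf rX); rewrite mulVf // -valX -lE.
  have : lQ l r * (lQ l r)^-1 = 1 by rewrite divff.
  by move=> /(congr1 (@Qlr_val _ l r)).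
exact: classification.
Qed.
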